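(* Let $\mathcal{A}$ be a strongly maximal triangular subalgebra of an AF $C^*$-algebra $\mathcal{C}$. If $\pi\colon\mathcal{A}\to\mathcal{B}(\mathcal{H})$ is a masa preserving, order type $-\mathbb{N}$, multiplicity free representation, then every invariant linear manifold for $\pi(\mathcal{A})$ is closed and singly generated.
   Context: All Hilbert spaces are separable, and all algebras and representations are assumed unital. A masa is a maximal abelian self-adjoint subalgebra. Let $\mathcal{C}$ be an AF $C^*$-algebra. For a masa $\mathcal{D}\subseteq\mathcal{C}$ put $$N_{\mathcal{D}}(\mathcal{C})=\{f\in\mathcal{C}: f \text{ is a partial isometry and } fdf^*,\,f^*df\in\mathcal{D}\text{ for all } d\in\mathcal{D}\}.$$ $\mathcal{D}$ is a canonical masa in $\mathcal{C}$ if the closed linear span of $N_{\mathcal{D}}(\mathcal{C})$ is $\mathcal{C}$. A norm closed subalgebra $\mathcal{A}\subseteq\mathcal{C}$ is triangular (triangular AF, TAF) if $\mathcal{A}\cap\mathcal{A}^*$ is a canonical masa in $\mathcal{C}$; it is strongly maximal if moreover $\overline{\mathcal{A}+\mathcal{A}^*}=\mathcal{C}$. Write $\mathcal{D}=\mathcal{A}\cap\mathcal{A}^*$. A representation $\pi$ of $\mathcal{A}$ on $\mathcal{H}$ always means the restriction to $\mathcal{A}$ of a $*$-representation of $\mathcal{C}$ on $\mathcal{H}$. It is masa preserving if $\pi(\mathcal{D})$ is weakly dense in a masa in $\mathcal{B}(\mathcal{H})$; in this case the lattice $\operatorname{Lat}(\pi(\mathcal{A}))$ of closed $\pi(\mathcal{A})$-invariant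 subspaces (identified with their projections) is a nest, i.e. totally ordered. The representation $\pi$ has order type $-\mathbb{N}$ if $\operatorname{Lat}(\pi(\mathcal{A}))=\{0\}\cup\{P_0,P_{-1},P_{-2},\dots\}$ with $I=P_0>P_{-1}>P_{-2}>\cdots$ strictly decreasing and $\bigwedge_n P_{-n}=0$. It is multiplicity free if the nest $\operatorname{Lat}(\pi(\mathcal{A}))$ is multiplicity free, i.e. the von Neumann algebra generated by the nest is a masa in $\mathcal{B}(\mathcal{H})$; in the order type $-\mathbb{N}$ case this means each $P_{n+1}-P_n$ $(n=-1,-2,\dots)$ has rank one. An invariant linear manifold for $\pi(\mathcal{A})$ is a (not necessarily closed) linear subspace $\mathcal{M}\subseteq\mathcal{H}$ with $\pi(a)\mathcal{M}\subseteq\mathcal{M}$ for all $a\in\mathcal{A}$. It is singly generated if $\mathcal{M}=\{\pi(a)x: a\in\mathcal{A}\}$ for some $x\in\mathcal{H}$. *)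

(* Defs.v *)
From HB Require Import structures.
From mathcomp Require Import all_boot all_order all_algebra.
From mathcomp Require Import complex.
From mathcomp Require Import all_classical all_reals all_analysis.

Set Implicit Arguments.
Unset Strict Implicit.
Unset Printing Implicit Defensive.

Import Order.TTheory GRing.Theory Num.Theory.
Import numFieldNormedType.Exports.

Local Open Scope classical_set_scope.
Local Open Scope ring_scope.
Local Open Scope complex_scope.

(* Unital C*-algebras.  The product is a bundled bilinear map rather than a
   ring structure on the carrier: MathComp's only common descendants of the
   ring structures and the normed ones are the numeric domains, so the two
   hierarchies cannot be joined here. *)
HB.mixin Record isCStarAlgebra (R : realType) A
    of CompleteNormedModule R[i] A := {
  amul : {bilinear A -> A -> A};
  aone : A;
  star : A -> A;
  amulA : associative amul;
  amul1l : left_id aone amul;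
  amul1r : right_id aone amul;
  starK : involutive star;
  star_antilinear : forall (c : R[i]) (x y : A),
    star (c *: x + y) = Num.conj c *: star x + star y;
  starM : forall x y : A, star (amul x y) = amul (star y) (star x);
  ler_norm_amul : forall x y : A, `|amul x y| <= `|x| * `|y|;
  norm_starM : forall x : A, `|amul (star x) x| = `|x| ^+ 2
}.

#[short(type="cstarAlgType")]
HB.structure Definition CStarAlgebra (R : realType) :=
  {A of CompleteNormedModule R[i] A & isCStarAlgebra R A}.

Notation "x ** y" := (amul x y) (at level 40, left associativity) : ring_scope.

(* Complex Hilbert spaces; [inner] is linear in its first argument. *)
HB.mixin Record isHilbert (R : realType) H of CompleteNormedModule R[i] H := {
  inner : {dot H for Num.conj};
  norm_inner : forall x : H, `|x| ^+ 2 = inner x x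
}.

#[short(type="hilbertType")]
HB.structure Definition Hilbert (R : realType) :=
  {H of CompleteNormedModule R[i] H & isHilbert R H}.

Definition linear_manifold (K : pzRingType) (E : lmodType K) (V : set E) :=
  submod_closed (mem V).

Definition linear_span (K : pzRingType) (E : lmodType K) (S : set E) : set E :=
  smallest (@linear_manifold K E) S.

Section Algebras.
Context {R : realType} {C : cstarAlgType R}.
Implicit Types A B D : set C.

Definition subalgebra B :=
  [/\ linear_manifold B, B aone & forall x y, B x -> B y -> B (x ** y)].

Definition star_subalgebra B :=
  subalgebra B /\ forall x, B x -> B (star x).

Definition abelian_set B := forall x y, B x -> B y -> x ** y = y ** x.

Definition masa D :=
  [/\ star_subalgebra D, abelian_set D &
      forall E : set C, star_subalgebra E -> abelian_set E ->
        D `<=` E -> E = D].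

Definition finite_dimensional B := exists s : seq C, B = linear_span [set` s].

Definition projection (p : C) := star p = p /\ p ** p = p.

Definition partial_isometry (f : C) := projection (star f ** f).

Definition normalizer D : set C :=
  [set f | partial_isometry f /\
    forall d, D d -> D (f ** d ** star f) /\ D (star f ** d ** f)].

Definition canonical_masa D :=
  masa D /\ closure (linear_span (normalizer D)) = setT.

Definition diagonal A : set C := A `&` star @` A.

Definition triangular A :=
  [/\ closed A, subalgebra A & canonical_masa (diagonal A)].

Definition strongly_maximal_triangular A :=
  triangular A /\
  closure [set x + y | x in A & y in (star @` A : set C)] = setT.

End Algebras.

Definition AF (R : realType) (C : cstarAlgType R) :=
  exists F : nat -> set C,
    [/\ forall n, star_subalgebra (F n) /\ finite_dimensional (F n),
        forall n, F n `<=` F n.+1 &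
        closure (\bigcup_n F n) = setT].

Section Operators.
Context {R : realType} {H : hilbertType R}.
Implicit Types (T S : H -> H) (M : set (H -> H)) (V : set H) (L : set (set H)).

Definition bounded_operators : set (H -> H) :=
  [set T | linear T /\ continuous T].

Definition adjoint T S := forall x y : H, inner (T x) y = inner x (S y).

(* The weak operator topology: the coarsest one making every map
   T |-> <T x, y> continuous. *)
Definition wot : topologicalType := initial_topology
  (fun T => (fun p => inner (T p.1) p.2) : {ptws H * H -> R[i]^o}).

Definition wot_closure M : set (H -> H) :=
  bounded_operators `&` closure (M : set wot).

Definition op_star_subalgebra M :=
  [/\ M `<=` bounded_operators,
      linear_manifold M,
      M idfun,
      forall T S, M T -> M S -> M (T \o S) &
      forall T, M T -> exists2 S, M S & adjoint T S].

Definition op_abelian M := forall T S, M T -> M S -> T \o S = S \o T.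

Definition op_masa M :=
  [/\ op_star_subalgebra M, op_abelian M &
      forall N : set (H -> H), op_star_subalgebra N -> op_abelian N ->
        M `<=` N -> N = M].

Definition von_neumann_algebra M :=
  op_star_subalgebra M /\ wot_closure M = M.

Definition generated_von_neumann_algebra M : set (H -> H) :=
  smallest von_neumann_algebra M.

Definition orthogonal_projection V T :=
  forall x, V (T x) /\ forall y, V y -> inner (x - T x) y = 0.

Definition multiplicity_free_nest L :=
  op_masa (generated_von_neumann_algebra
    [set T | exists2 V, L V & orthogonal_projection V T]).

(* [P n] is the range of the projection P_{-n} of the nest; the meet of these
   projections is the projection onto the intersection of the ranges. *)
Definition order_type_negN L :=
  exists P : nat -> set H,
    [/\ P 0%N = setT, forall n, P n.+1 `<` P n, \bigcap_n P n = [set 0] &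
        L = [set [set 0]] `|` range P].

End Operators.

Section Representations.
Context {R : realType} {C : cstarAlgType R} {H : hilbertType R}.
Implicit Types (pi : C -> H -> H) (A : set C) (V : set H).

Definition star_representation pi :=
  [/\ forall a, bounded_operators (pi a),
      linear pi,
      pi aone = idfun,
      forall a b, pi (a ** b) = pi a \o pi b &
      forall a, adjoint (pi a) (pi (star a))].

Definition invariant_under pi A V := forall a x, A a -> V x -> V (pi a x).

Definition Lat pi A : set (set H) :=
  [set V | [/\ closed V, linear_manifold V & invariant_under pi A V]].

Definition masa_preserving pi A :=
  exists M : set (H -> H),
    [/\ op_masa M, pi @` diagonal A `<=` M &
        M `<=` wot_closure (pi @` diagonal A)].

Definition multiplicity_free pi A := multiplicity_free_nest (Lat pi A).

Definition has_order_type_negN pi A := order_type_negN (Lat pi A).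

Definition singly_generated pi A V := exists x : H, V = [set pi a x | a in A].

End Representations.

Definition separable_space (T : topologicalType) :=
  exists2 S : set T, countable S & dense S.

(* Main.v *)
Require Import Defs.
From mathcomp Require Import all_boot all_order all_algebra.
From mathcomp Require Import complex ring lra.
From mathcomp Require Import all_classical all_reals all_analysis.

(** The nest gives an orthonormal basis [e 0], [e 1], ... such that [P n] is the
    closed span of the [e k] with [k >= n]; the algebra acts by lower triangular
    matrices and its diagonal by diagonal matrices ([nest_basis_exists],
    [diagonal_interpolation]).  If [n] is least such that an invariant manifold
    [M] is not contained in [P n.+1], then [M] contains a vector [x] of [P n]
    outside [P n.+1], and it suffices to prove that the orbit [pi a x], [a] in
    [A], is all of [P n] ([orbit_full]): then [M = P n] is closed and generated
    by [x].

    The orbit is dense in [P n] because its closure is a member of the nest.  As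
    in the open mapping theorem, density becomes equality once every [y] in
    [P n] is approximated by [pi a (e n)] with [nrm a] at most a fixed multiple
    of [nrm y] ([bounded_transitivity], [approximate_solutions_exact]).  This is
    a Kaplansky density theorem for [A].  Triangular truncation is unbounded, so
    bounded elements of [A] cannot be obtained by truncating bounded elements of
    the C*-algebra; they are obtained as resolvents instead.

    Density yields an element of [A], of unknown norm, whose sum [h] with its
    adjoint is close on finitely many basis vectors to the operator [swap n y]
    that exchanges [e n] and [y].  Then [r = 2 h / (1 + h ^ 2)] is a bounded
    self-adjoint element still close to [swap n y] ([bounded_real_transform]).
    As [A + A^*] is dense, some [a] in [A] has [a + a^*] close to [8 + r]; this
    is positive, so [(1 + a)^-1] lies in [A] and is bounded by [2]
    ([accretive_inverse_real_part]).  By triangularity [a + a^*] determines [a],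
    up to a correction by a diagonal element ([lower_triangular_part],
    [triangular_real_part]), and [(1 + a)^-1] sends
    [e n] close to an explicit combination of [e n] and [y]
    ([bounded_transitivity_unit]).

    The representation is contractive because [1 - a^* a] is a square when
    [nrm a < 1] ([sqrt_one_sub], [nrm_repr]).  Orthogonal projections and
    adjoints are constructed from completeness ([projection_exists],
    [riesz_representation], [adjoint_exists]); they serve to find the basis and
    to see that the commutant of a rank-one projection is a von Neumann
    algebra. *)

Set Implicit Arguments.
Unset Strict Implicit.
Unset Printing Implicit Defensive.

Import Order.TTheory GRing.Theory Num.Theory.
Import numFieldNormedType.Exports.

Local Open Scope classical_set_scope.
Local Open Scope ring_scope.
Local Open Scope complex_scope.

(** * Real-valued norms over the complex numbers *)

Section RealNorm.
Context {R : realType}.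

Lemma realcD (a b : R) : (a + b)%:C = a%:C + b%:C.
Proof. exact: (rmorphD (real_complex R)). Qed.

Lemma realcN (a : R) : (- a)%:C = - a%:C.
Proof. exact: (rmorphN (real_complex R)). Qed.

Lemma realcM (a b : R) : (a * b)%:C = a%:C * b%:C.
Proof. exact: (rmorphM (real_complex R)). Qed.

Lemma realcV (a : R) : (a^-1)%:C = (a%:C)^-1.
Proof. exact: (fmorphV (real_complex R)). Qed.

Lemma realcX (a : R) n : (a ^+ n)%:C = a%:C ^+ n.
Proof. exact: (rmorphXn (real_complex R)). Qed.

Lemma realc_nat n : (n%:R : R)%:C = n%:R.
Proof. exact: (rmorph_nat (real_complex R)). Qed.

Lemma conj_realc (a : R) : Num.conj (a%:C : R[i]) = a%:C.
Proof. exact: conjc_real. Qed.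

Lemma conjM (a b : R[i]) : Num.conj (a * b) = Num.conj a * Num.conj b.
Proof. exact: (rmorphM Num.conj). Qed.

Definition realcE := (realc_nat, realcX, realcD, realcN, realcM, realcV).

(** Norms of complex normed spaces take their values in [R[i]], where the order
    is only partial; estimates are carried out on their real parts. *)
Definition nrm (V : normedZmodType R[i]) (x : V) : R := complex.Re `|x|.

Lemma nrmE (V : normedZmodType R[i]) (x : V) : `|x| = (nrm x)%:C.
Proof. by rewrite /nrm RRe_real // ger0_real. Qed.

Section NormedZmod.
Context {V : normedZmodType R[i]}.
Implicit Types x y z : V.

Lemma nrm_ge0 x : 0 <= nrm x.
Proof. by rewrite -lecR -nrmE; exact: normr_ge0. Qed.

Lemma nrm0 : nrm (0 : V) = 0.
Proof. by rewrite /nrm normr0. Qed.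

Lemma nrm_eq0 x : nrm x = 0 -> x = 0.
Proof. by move=> x0; apply/eqP; rewrite -normr_eq0 nrmE x0. Qed.

Lemma nrmD x y : nrm (x + y) <= nrm x + nrm y.
Proof. by rewrite -lecR rmorphD /= -!nrmE; exact: ler_normD. Qed.

Lemma nrmN x : nrm (- x) = nrm x.
Proof. by rewrite /nrm normrN. Qed.

Lemma nrmB x y : nrm (x - y) <= nrm x + nrm y.
Proof. by rewrite -[nrm y]nrmN; exact: nrmD. Qed.

Lemma nrm_sym x y : nrm (x - y) = nrm (y - x).
Proof. by rewrite -nrmN opprB. Qed.

Lemma nrm_triangle y x z : nrm (x - z) <= nrm (x - y) + nrm (y - z).
Proof. by rewrite (_ : x - z = (x - y) + (y - z)) ?nrmD // addrA subrK. Qed.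

Lemma nrm_le_add x y : nrm x <= nrm y + nrm (x - y).
Proof. by rewrite -{1}[x](subrK y) addrC; exact: nrmD. Qed.

Lemma nrm_eps_eq0 x : (forall e : R, 0 < e -> nrm x <= e) -> x = 0.
Proof.
move=> xe; apply: nrm_eq0; apply/eqP; rewrite eq_le nrm_ge0 andbT.
by apply/ler_addgt0Pr => e e0; rewrite add0r xe.
Qed.

End NormedZmod.

Lemma nrm_sum (V : normedZmodType R[i]) (I : Type) (r : seq I) (F : I -> V) :
  nrm (\sum_(i <- r) F i) <= \sum_(i <- r) nrm (F i).
Proof.
elim/big_ind2 : _ => //; first by rewrite nrm0.
by move=> x a y b xa yb; apply: (le_trans (nrmD _ _)); exact: lerD.
Qed.

Lemma nrmZ (V : normedModType R[i]) (c : R[i]) (x : V) :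
  nrm (c *: x) = nrm c * nrm x.
Proof.
apply: (@complexI R); rewrite rmorphM /= -!nrmE.
exact: normrZ.
Qed.

Lemma nrmM (c d : R[i]) : nrm (c * d) = nrm c * nrm d.
Proof. by apply: (@complexI R); rewrite rmorphM /= -!nrmE normrM. Qed.

Lemma nrm_real (a : R) : nrm a%:C = `|a|.
Proof.
by rewrite /nrm normc_def /= expr0n addr0 sqrtr_sqr.
Qed.

Lemma nrm_nat n : nrm (n%:R : R[i]) = n%:R.
Proof. by rewrite -realc_nat nrm_real ger0_norm. Qed.

Lemma nrm1 : nrm (1 : R[i]) = 1.
Proof. by rewrite /nrm normr1. Qed.

Lemma nrmi : nrm ('i : R[i]) = 1.
Proof. by rewrite /nrm normc_def /= expr0n expr1n add0r sqrtr1. Qed.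

Lemma nrmV (c : R[i]) : nrm c^-1 = (nrm c)^-1.
Proof.
apply: (@complexI R); rewrite -nrmE normfV nrmE.
by rewrite fmorphV.
Qed.

Lemma nrm_gt0 (V : normedZmodType R[i]) (x : V) : x != 0 -> 0 < nrm x.
Proof.
move=> x0; rewrite lt_neqAle nrm_ge0 andbT eq_sym.
by apply: contraNneq x0 => /nrm_eq0 ->.
Qed.

Lemma nrm_sqr (c : R[i]) : (nrm c)%:C ^+ 2 = c * Num.conj c.
Proof. by rewrite -nrmE sqr_normc. Qed.

Lemma ball_nrm (V : normedModType R[i]) (x y : V) (e : R) :
  ball x e%:C y = (nrm (x - y) < e).
Proof. by rewrite -ball_normE /= nrmE ltcR. Qed.

Lemma closure_nrm (V : normedModType R[i]) (S : set V) (x : V) :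
  closure S x <-> forall e : R, 0 < e -> exists2 y, S y & nrm (x - y) < e.
Proof.
split=> [clSx e e0|Sx B /nbhs_ballP [e /= e0 eB]].
  have /clSx [y [Sy]] : nbhs x (ball x e%:C).
    by apply: nbhsx_ballx; rewrite ltcR.
  by rewrite ball_nrm => xy; exists y.
have eE : e = (complex.Re e)%:C by rewrite RRe_real // gtr0_real.
move: e0 eB; rewrite eE ltcR => e0 eB.
have [y Sy xy] := Sx _ e0; exists y; split => //.
by apply: eB; rewrite ball_nrm.
Qed.

Lemma closed_nrm (V : normedModType R[i]) (S : set V) (x : V) : closed S ->
  (forall e : R, 0 < e -> exists2 y, S y & nrm (x - y) < e) -> S x.
Proof. by move=> clS /closure_nrm; exact: clS. Qed.

Lemma geometric_small (K q : R) : 0 <= q < 1 ->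
  forall e, 0 < e -> exists k, K * q ^+ k < e.
Proof.
move=> /andP[q0 q1] e e0.
have : geometric K q n @[n --> \oo] --> (0 : R).
  by apply: cvg_geometric; rewrite ger0_norm.
move=> /cvgrPdist_lt /(_ _ e0) [N _ /(_ N (leqnn N))].
rewrite /= sub0r normrN => /(le_lt_trans (ler_norm _)) ?.
by exists N.
Qed.

(** The explicit rate of convergence replaces all later limit arguments: a
    vector is shown to vanish, or to lie in a closed set, by making the right-hand
    side small. *)
Lemma geometric_cauchy_cvg (V : completeNormedModType R[i]) (u : nat -> V)
    (K q : R) : 0 <= q < 1 ->
  (forall k, nrm (u k.+1 - u k) <= K * q ^+ k) ->
  exists l, forall k, nrm (l - u k) <= K / (1 - q) * q ^+ k.
Proof.
move=> /[dup] q01 /andP[q0 q1] du; have q1' : 0 < 1 - q by rewrite subr_gt0.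
have K0 : 0 <= K.
  by have := le_trans (nrm_ge0 _) (du 0%N); rewrite expr0 mulr1.
have tail k m : nrm (u (k + m)%N - u k) <= K / (1 - q) * (q ^+ k - q ^+ (k + m)).
  elim: m => [|m IHm]; first by rewrite addn0 !subrr mulr0 nrm0.
  apply: (le_trans (nrm_triangle (u (k + m)%N) _ _)).
  rewrite addnS; apply: (le_trans (lerD (du _) IHm)).
  rewrite exprS le_eqVlt; apply/orP; left; apply/eqP.
  by field; rewrite gt_eqF.
have tail' k m : nrm (u (k + m)%N - u k) <= K / (1 - q) * q ^+ k.
  apply: (le_trans (tail k m)); apply: ler_wpM2l; first by rewrite divr_ge0 // ltW.
  by rewrite gerBl exprn_ge0.
have : cvg (u @ \oo).
  apply/cauchy_cvgP/cauchy_exP => e e0.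
  have eE : e = (complex.Re e)%:C by rewrite RRe_real // gtr0_real.
  move: e0; rewrite eE ltcR => e0.
  have [k ke] := geometric_small (K / (1 - q)) q01 e0.
  exists (u k), k => // n /= kn; rewrite ball_nrm nrm_sym -(subnKC kn).
  exact: le_lt_trans (tail' _ _) ke.
move=> /cvg_ex [l ul]; exists l => k.
apply/ler_addgt0Pr => e e0.
have /ul [N _ /(_ (k + N)%N)] : nbhs l (ball l e%:C).
  by apply: nbhsx_ballx; rewrite ltcR.
rewrite /= leq_addl => /(_ isT); rewrite ball_nrm => lu.
apply: (le_trans (nrm_triangle (u (k + N)%N) _ _)).
by rewrite addrC lerD // ltW.
Qed.

End RealNorm.

(** * Bounded operators and the Hilbert space *)

Section LinearMaps.
Context {R : realType}.

Lemma linear_manifoldP (V : lmodType R[i]) (S : set V) : linear_manifold S <->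
  S 0 /\ forall (a : R[i]) x y, S x -> S y -> S (a *: x + y).
Proof.
split=> [[S0 SD]|[S0 SD]]; split.
- by move: S0; rewrite inE.
- by move=> a x y Sx Sy; have := SD a x y; rewrite !inE; apply.
- by rewrite inE.
- by move=> a x y; rewrite !inE; exact: SD.
Qed.

Section Manifold.
Variables (V : lmodType R[i]) (S : set V).
Hypothesis linS : linear_manifold S.

Lemma manifold0 : S 0.
Proof. by have /linear_manifoldP[] := linS. Qed.

Lemma manifoldZ (a : R[i]) x : S x -> S (a *: x).
Proof.
have /linear_manifoldP[S0 SD] := linS.
by move=> Sx; rewrite -[_ *: _]addr0; exact: SD.
Qed.

Lemma manifoldD x y : S x -> S y -> S (x + y).
Proof.
have /linear_manifoldP[_ SD] := linS.
by move=> Sx Sy; rewrite -[x]scale1r; exact: SD.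
Qed.

Lemma manifoldN x : S x -> S (- x).
Proof. by move=> Sx; rewrite -scaleN1r; exact: manifoldZ. Qed.

Lemma manifoldB x y : S x -> S y -> S (x - y).
Proof. by move=> Sx Sy; apply: manifoldD => //; exact: manifoldN. Qed.

Lemma manifold_sum (I : eqType) (r : seq I) (F : I -> V) :
  (forall i, i \in r -> S (F i)) -> S (\sum_(i <- r) F i).
Proof.
move=> SF; rewrite big_seq; elim/big_ind : _ => //; first exact: manifold0.
exact: manifoldD.
Qed.

End Manifold.

Lemma closure_manifold (V : normedModType R[i]) (S : set V) :
  linear_manifold S -> linear_manifold (closure S).
Proof.
move=> linS; apply/linear_manifoldP; split.
  by apply: subset_closure; exact: manifold0.
move=> a x y /closure_nrm clx /closure_nrm cly; apply/closure_nrm => e e0.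
have a1 : 0 < nrm a + 1 by rewrite ltr_wpDl ?nrm_ge0.
have [|u Su xu] := clx (e / 2 / (nrm a + 1)); first by rewrite !divr_gt0.
have [|v Sv yv] := cly (e / 2); first by rewrite divr_gt0.
exists (a *: u + v); first by apply: manifoldD => //; exact: manifoldZ.
rewrite opprD addrACA -scalerBr; apply: le_lt_trans (nrmD _ _) _.
rewrite nrmZ; move: xu; rewrite ltr_pdivlMr // => xu.
have := nrm_ge0 (x - u); have := nrm_ge0 a.
by move: (nrm a) (nrm (x - u)) xu yv => p q; lra.
Qed.

(** The operators of a representation satisfy [linear] as a proposition and
    carry no bundled linear structure. *)
Section Linear.
Variables (V W : lmodType R[i]) (T : V -> W).
Hypothesis linT : linear T.

Lemma lin0 : T 0 = 0.
Proof. by have := linT (-1) 0 0; rewrite scaler0 addr0 scaleN1r addNr. Qed.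

Lemma linD x y : T (x + y) = T x + T y.
Proof. by have := linT 1 x y; rewrite !scale1r. Qed.

Lemma linZ a x : T (a *: x) = a *: T x.
Proof. by rewrite -[a *: x]addr0 linT lin0 addr0. Qed.

Lemma linN x : T (- x) = - T x.
Proof. by rewrite -scaleN1r linZ scaleN1r. Qed.

Lemma linB x y : T (x - y) = T x - T y.
Proof. by rewrite linD linN. Qed.

Lemma lin_sum (I : Type) (r : seq I) (F : I -> V) :
  T (\sum_(i <- r) F i) = \sum_(i <- r) T (F i).
Proof. exact: (big_morph T linD lin0). Qed.

End Linear.

Lemma linear_continuousP (V W : normedModType R[i]) (T : V -> W) : linear T ->
  continuous T <-> exists K : R, forall x, nrm (T x) <= K * nrm x.
Proof.
move=> linT; split=> [cT|[K TK] x].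
  have /cT : nbhs (T 0) (ball (T 0) 1).
    by apply: nbhsx_ballx.
  move=> /nbhs_ballP [e /= e0 eT].
  have eE : e = (complex.Re e)%:C by rewrite RRe_real // gtr0_real.
  move: e0 eT; rewrite eE ltcR; set d := complex.Re e => d0 dT.
  exists (2 / d) => x; have [->|x0] := eqVneq x 0.
    by rewrite lin0 // !nrm0 mulr0.
  have nx0 := nrm_gt0 x0.
  set c := (d / 2 / nrm x); have c0 : 0 < c by rewrite !divr_gt0.
  have /dT : ball 0 d%:C (c%:C *: x).
    rewrite ball_nrm sub0r nrmN nrmZ nrm_real gtr0_norm // /c divfK ?gt_eqF //.
    by rewrite ltr_pdivrMr // ltr_pMr // ltr1n.
  rewrite /= (_ : 1 = 1%:C) // ball_nrm lin0 // sub0r nrmN linZ // nrmZ.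
  rewrite nrm_real gtr0_norm // => cT1.
  have -> : 2 / d * nrm x = c^-1 by rewrite /c; field; rewrite !gt_eqF.
  by rewrite -[_^-1]mul1r ler_pdivlMr // mulrC ltW.
have {}TK : forall z, nrm (T z) <= `|K| * nrm z.
  by move=> z; apply: le_trans (TK z) _; rewrite ler_wpM2r ?nrm_ge0 ?ler_norm.
apply/cvgrPdist_lt => e e0.
have eE : e = (complex.Re e)%:C by rewrite RRe_real // gtr0_real.
move: e0; rewrite eE ltcR; set d := complex.Re e => d0.
have K1 : 0 < `|K| + 1 by rewrite ltr_pwDr.
apply/nbhs_ballP; exists (d / (`|K| + 1))%:C => /=.
  by rewrite ltcR divr_gt0.
move=> y; rewrite ball_nrm nrmE ltcR => xy.
rewrite -linB //; apply: le_lt_trans (TK _) _.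
have : nrm (x - y) * (`|K| + 1) < d by rewrite -ltr_pdivlMr.
by apply: le_lt_trans; rewrite mulrC ler_wpM2l ?nrm_ge0 // lerDl.
Qed.

End LinearMaps.

Section HilbertSpace.
Context {R : realType} {H : hilbertType R}.
Implicit Types (x y z : H) (V : set H).

Lemma innerDl x y z : inner (x + y) z = inner x z + inner y z.
Proof. by rewrite linearDl. Qed.

Lemma innerDr x y z : inner z (x + y) = inner z x + inner z y.
Proof. by rewrite linearDr. Qed.

Lemma innerNl x z : inner (- x) z = - inner x z.
Proof. by rewrite linearNl. Qed.

Lemma innerNr x z : inner z (- x) = - inner z x.
Proof. by rewrite linearNr. Qed.

Lemma innerZl (a : R[i]) x z : inner (a *: x) z = a * inner x z.
Proof. by rewrite linearZl_LR. Qed.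

Lemma innerZr (a : R[i]) x z : inner z (a *: x) = Num.conj a * inner z x.
Proof. by rewrite linearZr_LR. Qed.

Lemma inner0l x : inner 0 x = 0.
Proof. by rewrite linear0l. Qed.

Lemma inner0r x : inner x 0 = 0.
Proof. by rewrite linear0r. Qed.

Lemma innerC x y : inner x y = Num.conj (inner y x).
Proof. by rewrite hermC /= expr0 mul1r. Qed.

Lemma inner_suml (I : Type) (r : seq I) (F : I -> H) z :
  inner (\sum_(i <- r) F i) z = \sum_(i <- r) inner (F i) z.
Proof.
by apply: (big_morph (fun x => inner x z)) => [x y|]; rewrite (innerDl, inner0l).
Qed.

Lemma inner_nrm x : inner x x = (nrm x)%:C ^+ 2.
Proof. by rewrite -norm_inner nrmE. Qed.

Definition innerE := (innerDl, innerDr, innerNl, innerNr, innerZl, innerZr,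
  inner0l, inner0r).

(** Linear identities between vectors are proved by testing them against all
    vectors, which turns them into ring identities. *)
Lemma inner_ext x y : (forall z, inner x z = inner y z) -> x = y.
Proof.
move=> xy; apply/eqP; rewrite -subr_eq0; apply/eqP; apply: nrm_eq0.
apply/eqP; rewrite -sqrf_eq0; apply/eqP; apply: (@complexI R).
by rewrite realcX -inner_nrm innerDl innerNl xy subrr.
Qed.

Lemma inner_eq0C x y : inner x y = 0 -> inner y x = 0.
Proof. by move=> xy; rewrite innerC xy conjC0. Qed.

Lemma cauchy_schwarz x y : nrm (inner x y) <= nrm x * nrm y.
Proof.
have [->|y0] := eqVneq y 0; first by rewrite inner0r !nrm0 mulr0.
have ny0 := nrm_gt0 y0.
set n := nrm y ^+ 2; set c := inner x y.
have n0 : 0 < n by rewrite exprn_gt0.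
have : 0 <= nrm (n%:C *: x - c *: y) ^+ 2 by rewrite sqr_ge0.
have -> : nrm (n%:C *: x - c *: y) ^+ 2 = n * (n * nrm x ^+ 2 - nrm c ^+ 2).
  apply: (@complexI R); rewrite realcX -inner_nrm !innerE !inner_nrm -/c.
  by rewrite [inner y x]innerC -/c conj_realc !realcE !nrm_sqr; ring.
rewrite pmulr_rge0 // subr_ge0 => cn.
rewrite -ler_sqr ?nnegrE ?mulr_ge0 ?nrm_ge0 //.
by rewrite exprMn mulrC.
Qed.

Lemma parallelogram x y :
  nrm (x + y) ^+ 2 + nrm (x - y) ^+ 2 = 2 * nrm x ^+ 2 + 2 * nrm y ^+ 2.
Proof.
by apply: (@complexI R); rewrite !realcE -!inner_nrm !innerE; ring.
Qed.

Lemma pythagoras x y : inner x y = 0 ->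
  nrm (x + y) ^+ 2 = nrm x ^+ 2 + nrm y ^+ 2.
Proof.
move=> xy; apply: (@complexI R).
by rewrite !realcE -!inner_nrm !innerE xy (inner_eq0C xy) add0r addr0.
Qed.

Lemma nrm_sub_scale x y (s : R) (c := inner x y) :
  nrm (x - (s%:C * c) *: y) ^+ 2 =
  nrm x ^+ 2 - 2 * s * nrm c ^+ 2 + s ^+ 2 * nrm c ^+ 2 * nrm y ^+ 2.
Proof.
apply: (@complexI R); rewrite !realcE -!inner_nrm !nrm_sqr !innerE.
by rewrite [inner y x]innerC -/c conjM conj_realc; ring.
Qed.

(** * Orthogonal projections and the Riesz representation *)

(** A sequence of almost closest points of [V] is Cauchy by the parallelogram
    identity, and the error vector of its limit is orthogonal to [V]. *)
Lemma projection_exists V x : closed V -> linear_manifold V ->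
  exists p, V p /\ forall v, V v -> inner (x - p) v = 0.
Proof.
move=> clV linV.
pose D := [set nrm (x - v) | v in V].
have D0 : D !=set0 by exists (nrm (x - 0)), 0 => //; exact: manifold0.
have lbD : lbound D 0 by move=> _ [v _ <-]; exact: nrm_ge0.
have hD : has_inf D by split => //; exists 0.
set d := inf D.
have d0 : 0 <= d by exact: lb_le_inf.
have dV v : V v -> d <= nrm (x - v).
  by move=> Vv; apply: ge_inf; [exists 0|exists v].
have near_inf k : exists v, V v /\ nrm (x - v) ^+ 2 <= d ^+ 2 + (4^-1) ^+ k.
    have e0 : 0 < (4^-1 : R) ^+ k by rewrite exprn_gt0.
    have [|t [v Vv <-] tk] := @inf_lt _ D (Num.sqrt (d ^+ 2 + 4^-1 ^+ k)) D0.
      rewrite -[inf D]ger0_norm // -sqrtr_sqr ltr_sqrt ?ltrDl //.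
      by rewrite ltr_wpDl // sqr_ge0.
    exists v; split=> //; rewrite -[leRHS]sqr_sqrtr ?addr_ge0 ?sqr_ge0 ?(ltW e0) //.
    by rewrite ler_sqr ?nnegrE ?nrm_ge0 ?sqrtr_ge0 ?ltW.
have [u uP] := choice near_inf.
have mid v w : V v -> V w -> d ^+ 2 <= nrm (x - (2^-1 : R[i]) *: (v + w)) ^+ 2.
  move=> Vv Vw; rewrite ler_sqr ?nnegrE ?nrm_ge0 // dV //.
  by apply: manifoldZ => //; exact: manifoldD.
have uu k : nrm (u k.+1 - u k) <= 2 * (2^-1) ^+ k.
  have [Vk xk] := uP k; have [Vk1 xk1] := uP k.+1.
  have := parallelogram (x - u k) (x - u k.+1).
  rewrite (_ : (x - u k) - (x - u k.+1) = u k.+1 - u k); last first.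
    by apply: inner_ext => z; rewrite !innerE; ring.
  have -> : x - u k + (x - u k.+1) = (2 : R[i]) *: (x - (2^-1 : R[i]) *: (u k + u k.+1)).
    apply: inner_ext => z; rewrite !innerE.
    by field.
  rewrite nrmZ exprMn (_ : nrm (2 : R[i]) = 2); last first.
    exact: nrm_nat.
  move=> pl; have := mid _ _ Vk Vk1.
  have s0 : 0 <= 2 * (2^-1 : R) ^+ k by rewrite mulr_ge0 ?exprn_ge0.
  rewrite -(ler_sqr (nrm_ge0 _) s0) exprMn -exprM mulnC exprM.
  rewrite (_ : 2^-1 ^+ 2 = 4^-1 :> R); last by field.
  have : (4^-1 : R) ^+ k.+1 <= 4^-1 ^+ k.
    by rewrite exprS ler_piMl ?exprn_ge0 // invf_le1 // ler1n.
  by move: (4^-1 ^+ k) (4^-1 ^+ k.+1) xk xk1 pl => q q'; nra.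
have half01 : 0 <= (2^-1 : R) < 1.
  by rewrite invr_ge0 ler0n /= invf_lt1 ?ltr1n.
have [l lu] := geometric_cauchy_cvg half01 uu.
have Vl : V l.
  apply: closed_nrm => // e e0.
  have [k ke] := geometric_small (2 / (1 - 2^-1)) half01 e0.
  by exists (u k); [have [] := uP k|exact: le_lt_trans (lu k) ke].
have xl : nrm (x - l) <= d.
  apply/ler_addgt0Pr => e e0.
  have [k ke] := geometric_small 5 half01 e0.
  have [_ xk] := uP k.
  have {}xk : nrm (x - u k) <= d + 2^-1 ^+ k.
    have h0 : 0 <= (2^-1 : R) ^+ k by rewrite exprn_ge0.
    rewrite -ler_sqr ?nnegrE ?nrm_ge0 ?addr_ge0 //.
    apply: le_trans xk _; rewrite (_ : 4^-1 = 2^-1 ^+ 2); last by field.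
    by rewrite -exprM mulnC exprM; nra.
  have := nrm_triangle (u k) x l; have := lu k; rewrite [nrm (l - _)]nrm_sym.
  rewrite (_ : 2 / (1 - 2^-1) = 4 :> R); last by field.
  by move: (2^-1 ^+ k) ke xk => q; lra.
exists l; split => // v Vv.
set c := inner (x - l) v; set n := nrm v ^+ 2.
have n0 : 0 <= n by rewrite sqr_ge0.
pose s := (n + 1)^-1; have n1 : 0 < n + 1 by rewrite ltr_wpDl.
have s0 : 0 < s by rewrite invr_gt0.
have : d ^+ 2 <= nrm (x - (l + (s%:C * c) *: v)) ^+ 2.
  rewrite ler_sqr ?nnegrE ?nrm_ge0 // dV //.
  by apply: manifoldD => //; exact: manifoldZ.
have -> : nrm (x - (l + (s%:C * c) *: v)) ^+ 2 =
    nrm (x - l) ^+ 2 - 2 * s * nrm c ^+ 2 + s ^+ 2 * nrm c ^+ 2 * n.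
  by rewrite opprD addrA nrm_sub_scale.
have : nrm (x - l) ^+ 2 <= d ^+ 2 by rewrite ler_sqr ?nnegrE ?nrm_ge0.
move=> h1 h2; have c0 : 0 <= nrm c ^+ 2 by rewrite sqr_ge0.
have sn : s * n <= 1 by rewrite mulrC ler_pdivrMr // mul1r lerDl.
have : s * nrm c ^+ 2 * (2 - s * n) <= 0 by lra.
have p2 : 0 < 2 - s * n by lra.
rewrite (pmulr_lle0 _ p2) (pmulr_rle0 _ s0) => cle.
by apply: nrm_eq0; apply/eqP; rewrite -sqrf_eq0 eq_le cle.
Qed.

(** The orthogonal complement of the kernel of a nonzero functional is a line;
    [f] and the inner product with a suitable vector of it agree. *)
Lemma riesz_representation (f : H -> R[i]) (K : R) :
  linear (f : H -> R[i]^o) -> (forall x, nrm (f x) <= K * nrm x) ->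
  exists y, forall x, f x = inner x y.
Proof.
move=> linf fK.
have [f0|] := pselect (forall x, f x = 0).
  by exists 0 => x; rewrite inner0r f0.
move=> /existsNP[x0 /eqP fx0].
pose V := [set x | f x = 0].
have fB x y : f (x - y) = f x - f y by exact: (linB linf).
have fZ a x : f (a *: x) = a * f x by exact: (linZ linf).
have linV : linear_manifold V.
  apply/linear_manifoldP; split; first exact: (lin0 linf).
  by move=> a x y fx fy; rewrite /V /= linf fx fy scaler0 addr0.
have clV : closed V.
  move=> x /closure_nrm xV; apply: nrm_eps_eq0 => e e0.
  have K1 : 0 < `|K| + 1 by rewrite ltr_wpDl.
  have [|y fy xy] := xV (e / (`|K| + 1)); first by rewrite divr_gt0.
  have -> : f x = f (x - y) by rewrite fB fy subr0.
  apply: le_trans (fK _) _; move: xy; rewrite ltr_pdivlMr // => xy.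
  have := nrm_ge0 (x - y); have := ler_norm K; nra.
have [p [Vp pV]] := projection_exists x0 clV linV.
set z := x0 - p; have fz : f z = f x0 by rewrite /z fB Vp subr0.
have z0 : z != 0.
  apply: contra fx0 => /eqP z0; rewrite -fz z0; apply/eqP; exact: (lin0 linf).
have zz : inner z z != 0.
  by rewrite inner_nrm -realcX (inj_eq (@complexI R)) sqrf_eq0 gt_eqF // nrm_gt0.
exists (Num.conj (f z / inner z z) *: z) => x.
rewrite innerZr conjCK.
have : inner z (x - (f x / f z) *: z) = 0.
  by apply: pV; rewrite /V /= fB fZ divfK ?subrr // fz.
move: (z) fz zz => w fz zz.
move=> /inner_eq0C; rewrite !innerE => /eqP; rewrite subr_eq0 => /eqP ->.
by field; rewrite fz fx0.
Qed.

Lemma adjoint_exists (T : H -> H) : bounded_operators T ->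
  exists2 S, bounded_operators S & adjoint T S.
Proof.
move=> [linT /(linear_continuousP linT)[K TK]].
have K0 z : 0 <= `|K| * nrm z by rewrite mulr_ge0 ?nrm_ge0.
have /choice[S TS] y : exists w, forall x, inner (T x) y = inner x w.
  apply: (@riesz_representation _ (K * nrm y)) => [a u v|x].
    by rewrite (linT a u v) !innerE.
  apply: le_trans (cauchy_schwarz _ _) _.
  by rewrite mulrAC ler_wpM2r ?nrm_ge0.
exists S => [|x y]; last exact: TS.
have linS : linear S.
  move=> a x y; apply: inner_ext => z; rewrite innerC -TS [RHS]innerC.
  by rewrite !innerDr !innerZr !TS.
split => //; apply/(linear_continuousP linS); exists `|K| => y.
have [->|Sy0] := eqVneq (S y) 0; first by rewrite nrm0.
rewrite -(ler_pM2r (nrm_gt0 Sy0)) -expr2 -lecR realcX -inner_nrm -TS.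
have := cauchy_schwarz (T (S y)) y.
rewrite {1}TS inner_nrm -realcX nrm_real normrX ger0_norm ?nrm_ge0 // => Sy.
rewrite TS inner_nrm -realcX lecR (le_trans Sy) // -mulrA [_ * nrm (S y)]mulrC mulrA.
rewrite ler_wpM2r ?nrm_ge0 //; apply: le_trans (TK _) _.
by rewrite ler_wpM2r ?nrm_ge0 ?ler_norm.
Qed.

End HilbertSpace.

(** * Solving linear equations by successive approximation *)

Section SuccessiveApproximation.
Context {R : realType}.

(** The iteration behind the open mapping theorem: a linear equation that can
    be solved up to a fixed proportion of the right-hand side, with control of
    the norm of the approximate solution, can be solved exactly. *)
Lemma approximate_solutions_exact (V : completeNormedModType R[i])
    (W : normedModType R[i]) (S : set V) (E : set W) (L : V -> W)
    (M K q : R) :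
  closed S -> linear_manifold S ->
  linear L -> (forall x, nrm (L x) <= M * nrm x) -> 0 <= q < 1 ->
  (forall y, E y -> exists x, [/\ S x, nrm x <= K * nrm y, E (y - L x) &
    nrm (y - L x) <= q * nrm y]) ->
  forall y, E y -> exists x, [/\ S x, L x = y & nrm x <= K / (1 - q) * nrm y].
Proof.
move=> clS linS linL LM q01 step y Ey.
have /choice[f fP] w : exists x, E w -> [/\ S x, nrm x <= K * nrm w,
    E (w - L x) & nrm (w - L x) <= q * nrm w].
  by have [/step[x xP]|nEw] := pselect (E w); [exists x|exists 0].
pose r k := iter k (fun w => w - L (f w)) y.
have rP k : E (r k) /\ nrm (r k) <= q ^+ k * nrm y.
  elim: k => [|k [Ek rk]]; first by rewrite expr0 mul1r.
  have [_ _ Ek1 rk1] := fP _ Ek; split => //.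
  rewrite exprS -mulrA; apply: le_trans rk1 _.
  by rewrite ler_wpM2l //; have /andP[] := q01.
pose u k := \sum_(i < k) f (r i).
have Su k : S (u k).
  by apply: manifold_sum => // i _; have [] := fP _ (rP i).1.
have Lu k : y - L (u k) = r k.
  elim: k => [|k IHk]; first by rewrite /u big_ord0 (lin0 linL) subr0.
  by rewrite /u big_ord_recr /= (linD linL) opprD addrA IHk.
have du k : nrm (u k.+1 - u k) <= K * nrm y * q ^+ k.
  rewrite /u big_ord_recr /= addrAC subrr add0r.
  have [_ fk _ _] := fP _ (rP k).1; apply: le_trans fk _.
  have [->|r0] := eqVneq (r k) 0.
    rewrite nrm0 mulr0 mulr_ge0 //; last by rewrite exprn_ge0 //; have /andP[] := q01.
    by have [_ f0 _ _] := fP _ Ey; apply: le_trans f0; exact: nrm_ge0.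
  have K0 : 0 <= K.
    have [_ fk _ _] := fP _ (rP k).1.
    by rewrite -(pmulr_lge0 _ (nrm_gt0 r0)); exact: le_trans (nrm_ge0 _) fk.
  by rewrite -mulrA [nrm y * _]mulrC ler_wpM2l //; have [] := rP k.
have [l lu] := geometric_cauchy_cvg q01 du.
exists l; split.
- apply: closed_nrm => // e e0.
  have [k ke] := geometric_small (K * nrm y / (1 - q)) q01 e0.
  by exists (u k) => //; exact: le_lt_trans (lu k) ke.
- apply/eqP; rewrite -subr_eq0 -oppr_eq0 opprB; apply/eqP.
  apply: nrm_eps_eq0 => e e0.
  have [k ke] := geometric_small (nrm y + `|M| * (K * nrm y / (1 - q))) q01 e0.
  have -> : y - L l = r k - L (l - u k).
    by rewrite -Lu (linB linL) opprB addrA subrK.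
  apply: le_trans (nrmB _ _) _; apply: le_trans (ltW ke).
  rewrite mulrDl lerD //; first by have [_] := rP k; rewrite mulrC.
  apply: le_trans (LM _) _; apply: (@le_trans _ _ (`|M| * nrm (l - u k))).
    by rewrite ler_wpM2r ?nrm_ge0 ?ler_norm.
  by rewrite -[leRHS]mulrA ler_wpM2l.
- have := lu 0%N; rewrite /u big_ord0 subr0 expr0 mulr1.
  by rewrite mulrAC.
Qed.

(** Up to the factor [t], [1 + N] is the difference of [1 + t] and [1 - t N],
    and the second term is dominated by the first, so the equation [x + N x = y]
    is solved up to the proportion [(1 + t / 2) / (1 + t)] by a multiple of [y].
    This is a substitute for the fact that an operator with nonnegative real
    part has a bounded resolvent at [-1], and it does not need the order of a
    C*-algebra. *)
Lemma accretive_surjective (V : completeNormedModType R[i]) (S : set V)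
    (N : V -> V) (M t : R) :
  closed S -> linear_manifold S ->
  linear N -> (forall x, nrm (N x) <= M * nrm x) -> 0 < t ->
  (forall x, S x -> S (N x)) ->
  (forall x, nrm (x - t%:C *: N x) <= (1 + t / 2) * nrm x) ->
  forall y, S y -> exists x, [/\ S x, x + N x = y & nrm x <= 2 * nrm y].
Proof.
move=> clS linS linN NM t0 SN Nt y Sy.
have t1 : 0 < 1 + t by rewrite addr_gt0.
have linL : linear (fun x => x + N x).
  by move=> a u v; rewrite linN scalerDr !addrA; congr (_ + _); rewrite addrAC.
have -> : 2 = (t / (1 + t)) / (1 - (1 + t / 2) / (1 + t)).
  field; apply/andP; split; lra.
have q01 : 0 <= (1 + t / 2) / (1 + t) < 1.
  apply/andP; split; first by rewrite divr_ge0 // ltW //; lra.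
  by rewrite ltr_pdivrMr //; lra.
apply: (@approximate_solutions_exact V V S S _ (1 + M)) => // [x|{Sy}y Sy].
  rewrite mulrDl mul1r.
  by apply: le_trans (nrmD _ _) _; rewrite lerD2l.
exists ((t / (1 + t))%:C *: y).
have -> : y - ((t / (1 + t))%:C *: y + N ((t / (1 + t))%:C *: y)) =
    ((1 + t)^-1)%:C *: (y - t%:C *: N y).
  rewrite (linZ linN) scalerBr scalerA -realcM opprD addrA [_^-1 * t]mulrC.
  congr (_ - _); rewrite -{1}[y]scale1r -scalerBl; congr (_ *: _).
  by rewrite -[1]/(1%:C) -realcN -realcD; congr (_%:C); field; rewrite gt_eqF.
split.
- exact: manifoldZ.
- by rewrite nrmZ nrm_real gtr0_norm // divr_gt0.
- by apply: manifoldZ => //; apply: manifoldB => //; apply: manifoldZ => //; exact: SN.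
- rewrite nrmZ nrm_real gtr0_norm ?invr_gt0 //.
  rewrite mulrAC [leRHS]mulrC ler_pM2l ?invr_gt0 //.
Qed.

End SuccessiveApproximation.

(** * C*-algebras: inverses and contractivity of representations *)

Section CStar.
Context {R : realType} {C : cstarAlgType R}.
Implicit Types a b c x y : C.

Lemma amulDl x y z : (x + y) ** z = x ** z + y ** z :> C.
Proof. by rewrite linearDl. Qed.

Lemma amulDr x y z : z ** (x + y) = z ** x + z ** y :> C.
Proof. by rewrite linearDr. Qed.

Lemma amulNl x z : (- x) ** z = - (x ** z) :> C.
Proof. by rewrite linearNl. Qed.

Lemma amulNr x z : z ** (- x) = - (z ** x) :> C.
Proof. by rewrite linearNr. Qed.

Lemma amulZl (k : R[i]) x z : (k *: x) ** z = k *: (x ** z) :> C.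
Proof. by rewrite linearZl_LR. Qed.

Lemma amulZr (k : R[i]) x z : z ** (k *: x) = k *: (z ** x) :> C.
Proof. by rewrite linearZr_LR. Qed.

Definition amulE := (amulDl, amulDr, amulNl, amulNr, amulZl, amulZr).

Lemma star0 : star (0 : C) = 0.
Proof.
have := star_antilinear (-1) (0 : C) 0; rewrite scaler0 addr0 => ->.
by rewrite rmorphN rmorph1 scaleN1r addNr.
Qed.

Lemma starD x y : star (x + y) = star x + star y.
Proof. by rewrite -[x]scale1r star_antilinear rmorph1 !scale1r. Qed.

Lemma starZ (k : R[i]) x : star (k *: x) = Num.conj k *: star x.
Proof. by rewrite -[k *: x]addr0 star_antilinear star0 addr0. Qed.

Lemma starN x : star (- x) = - star x.
Proof. by rewrite -scaleN1r starZ rmorphN rmorph1 scaleN1r. Qed.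

Lemma star1 : star (aone : C) = aone.
Proof. by rewrite -[LHS]amul1l -{1}[aone]starK -starM amul1l starK. Qed.

Lemma nrm_amul x y : nrm (x ** y) <= nrm x * nrm y.
Proof. by rewrite -lecR realcM -!nrmE; exact: ler_norm_amul. Qed.

Lemma nrm_starM x : nrm (star x ** x) = nrm x ^+ 2.
Proof. by apply: (@complexI R); rewrite realcX -!nrmE; exact: norm_starM. Qed.

Lemma nrm_star x : nrm (star x) = nrm x.
Proof.
have le y : nrm y <= nrm (star y).
  have [->|y0] := eqVneq y 0; first by rewrite nrm0 nrm_ge0.
  rewrite -(ler_pM2r (nrm_gt0 y0)) -expr2 -nrm_starM; exact: nrm_amul.
by apply/eqP; rewrite eq_le le andbT -{2}[x]starK le.
Qed.

Lemma nrm_aone : nrm (aone : C) <= 1.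
Proof.
have := nrm_starM aone; rewrite star1 amul1l => one2.
have [->|one0] := eqVneq (nrm (aone : C)) 0; first exact: ler01.
by rewrite le_eqVlt -(inj_eq (mulfI one0)) mulr1 -expr2 -one2 eqxx.
Qed.

Lemma subalgebra_manifold (B : set C) : subalgebra B -> linear_manifold B.
Proof. by case. Qed.

(** The C*-identity turns a bound on the real part of [a] into the
    infinitesimal contractivity of [1 - t a]. *)
Lemma nrm_one_sub a (t : R) : 0 <= t ->
  nrm (aone - t%:C *: a) ^+ 2 <=
  nrm (aone - t%:C *: (a + star a)) + t ^+ 2 * nrm a ^+ 2.
Proof.
move=> t0; rewrite -nrm_starM.
have -> : star (aone - t%:C *: a) ** (aone - t%:C *: a) =
    (aone - t%:C *: (a + star a)) + (t ^+ 2)%:C *: (star a ** a).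
  rewrite starD starN starZ star1 conj_realc !amulE !amul1l !amul1r.
  rewrite scalerDr !opprD !opprK scalerA -realcM -expr2 !addrA.
  by [].
apply: le_trans (nrmD _ _) _; rewrite lerD2l nrmZ nrm_real ger0_norm ?sqr_ge0 //.
by rewrite nrm_starM.
Qed.

(** Left and right multiplication by [a] both satisfy the hypotheses of
    [accretive_surjective], and the two one-sided inverses coincide. *)
Lemma accretive_inverse (B : set C) a (t : R) :
  closed B -> subalgebra B -> B a -> 0 < t ->
  nrm (aone - t%:C *: a) <= 1 + t / 2 ->
  exists g, [/\ B g, g ** (aone + a) = aone, (aone + a) ** g = aone &
    nrm g <= 2].
Proof.
move=> clB [linB B1 BM] Ba t0 at1.
have g2 g : nrm g <= 2 * nrm (aone : C) -> nrm g <= 2.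
  by move=> /le_trans; apply; rewrite ler_piMr // nrm_aone.
have [k x y|x|x Bx|x|g [Bg ag gn]] :=
    @accretive_surjective R C B (fun x => x ** a) (nrm a) t clB linB _ _ t0
      _ _ aone B1.
- by rewrite amulDl amulZl.
- by rewrite mulrC; exact: nrm_amul.
- exact: BM.
- rewrite -amulZr -{1}[x]amul1r -amulNr -amulDr mulrC.
  apply: le_trans (nrm_amul _ _) _; apply: ler_wpM2l => //; exact: nrm_ge0.
have [k x y|x|x Bx|x|h [Bh ah hn]] :=
    @accretive_surjective R C B (fun x => a ** x) (nrm a) t clB linB _ _ t0
      _ _ aone B1.
- by rewrite amulDr amulZr.
- exact: nrm_amul.
- exact: BM.
- rewrite -amulZl -{1}[x]amul1l -amulNl -amulDl.
  apply: le_trans (nrm_amul _ _) _; apply: ler_wpM2r => //; exact: nrm_ge0.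
have ga : g ** (aone + a) = aone by rewrite amulDr amul1r.
have ha : (aone + a) ** h = aone by rewrite amulDl amul1l.
exists g; split => //; last exact: g2.
by rewrite (_ : g = h) // -[g]amul1r -ha amulA ga amul1l.
Qed.

(** The iteration [y := (x + y^2) / 2] converges to a solution of
    [(1 - y)^2 = 1 - x]. *)
Lemma sqrt_one_sub x : star x = x -> nrm x < 1 ->
  exists2 b, star b = b & b ** b = aone - x.
Proof.
move=> xs x1.
pose f y := (2^-1 : R[i]) *: (x + y ** y).
pose u k := iter k f 0.
have half : Num.conj (2^-1 : R[i]) = 2^-1 by rewrite fmorphV rmorph_nat.
have nhalf : nrm (2^-1 : R[i]) = 2^-1.
  by rewrite nrmV nrm_nat.
have us k : star (u k) = u k.
  elim: k => [|k IHk]; first exact: star0.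
  by rewrite /= /f starZ starD starM half xs IHk.
have un k : nrm (u k) <= nrm x.
  elim: k => [|k IHk]; first by rewrite nrm0 nrm_ge0.
  rewrite /= /f nrmZ nhalf ler_pdivrMl //.
  apply: le_trans (nrmD _ _) _; have := nrm_amul (u k) (u k).
  by have := nrm_ge0 (u k); nra.
have sqB y z : y ** y - z ** z = y ** (y - z) + (y - z) ** z.
  by rewrite !amulE addrA subrK.
have du k : nrm (u k.+1 - u k) <= nrm x * nrm x ^+ k.
  elim: k => [|k IHk].
    rewrite subr0 /= /f linear0r addr0 nrmZ nhalf expr0 mulr1.
    by have := nrm_ge0 x; lra.
  rewrite [u k.+2]/= {1}[u k.+1]/= /f -scalerBr opprD addrACA subrr add0r.
  rewrite sqB nrmZ nhalf ler_pdivrMl //; apply: le_trans (nrmD _ _) _.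
  have := nrm_amul (u k.+1) (u k.+1 - u k); have := nrm_amul (u k.+1 - u k) (u k).
  have := un k; have := un k.+1; rewrite exprS.
  have := nrm_ge0 (u k.+1 - u k).
  move: IHk; move: (nrm x ^+ k) (nrm (u k.+1 - u k)) => q d.
  by have := nrm_ge0 (u k.+1); have := nrm_ge0 (u k); have := nrm_ge0 x; nra.
have x01 : 0 <= nrm x < 1 by rewrite nrm_ge0 x1.
have [y yu] := geometric_cauchy_cvg x01 du.
pose K := nrm x / (1 - nrm x).
have K0 : 0 <= K by rewrite divr_ge0 ?nrm_ge0 // subr_ge0 ltW.
have ys : star y = y.
  apply/eqP; rewrite -subr_eq0; apply/eqP; apply: nrm_eps_eq0 => e e0.
  have [k ke] := geometric_small (2 * K) x01 e0.
  apply: le_trans (nrm_triangle (u k) _ _) _; apply: le_trans (ltW ke).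
  rewrite -{1}us -starN -starD nrm_star [nrm (u k - y)]nrm_sym.
  by have := yu k; rewrite -/K; lra.
have yf : y = f y.
  apply/eqP; rewrite -subr_eq0; apply/eqP; apply: nrm_eps_eq0 => e e0.
  pose K' := K + 2^-1 * (nrm x + nrm y) * K.
  have [k ke] := geometric_small K' x01 e0.
  apply: le_trans (nrm_triangle (u k.+1) _ _) _; apply: le_trans (ltW ke).
  have yk : nrm (y - u k.+1) <= K * nrm x ^+ k.
    apply: le_trans (yu _) _; rewrite -/K ler_wpM2l // exprS.
    by rewrite ler_piMl ?exprn_ge0 ?nrm_ge0 // ltW.
  have uf : nrm (u k.+1 - f y) <= 2^-1 * (nrm x + nrm y) * (K * nrm x ^+ k).
    rewrite [u k.+1]/= /f -scalerBr opprD addrACA subrr add0r sqB nrmZ nhalf.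
    rewrite -mulrA ler_pM2l ?invr_gt0 //; apply: le_trans (nrmD _ _) _.
    have := nrm_amul (u k) (u k - y); have := nrm_amul (u k - y) y.
    have := un k; have := yu k; rewrite -/K [nrm (y - _)]nrm_sym.
    move: (K * _) (nrm (u k - y)) (nrm_ge0 (u k - y)) => q d.
    by have := nrm_ge0 y; have := nrm_ge0 (u k); nra.
  by rewrite /K' mulrDl -[X in _ <= _ + X]mulrA; exact: lerD.
exists (aone - y); first by rewrite starD starN star1 ys.
rewrite !amulE !amul1l !amul1r.
have -> : y ** y = (2 : R[i]) *: y - x.
  by rewrite {3}yf /f scalerA mulfV ?pnatr_eq0 // scale1r addrC addKr.
rewrite scaler_nat mulr2n addrA -[_ - y - y]addrA -opprD.
by move: (y + y) => z; rewrite opprK addrA subrK.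
Qed.

End CStar.

Section RepresentationNorm.
Context {R : realType} {C : cstarAlgType R} {H : hilbertType R}.
Variable pi : C -> H -> H.
Hypothesis repr : star_representation pi.
Implicit Types (a b : C) (u v w : H).

Lemma repr_linear a : linear (pi a).
Proof. by have [bpi _ _ _ _] := repr; have [] := bpi a. Qed.

Lemma reprD a b v : pi (a + b) v = pi a v + pi b v.
Proof. by have [_ lpi _ _ _] := repr; rewrite (linD lpi). Qed.

Lemma reprZ (k : R[i]) a v : pi (k *: a) v = k *: pi a v.
Proof. by have [_ lpi _ _ _] := repr; rewrite (linZ lpi). Qed.

Lemma reprN a v : pi (- a) v = - pi a v.
Proof. by have [_ lpi _ _ _] := repr; rewrite (linN lpi). Qed.

Lemma repr1 v : pi aone v = v.
Proof. by have [_ _ -> _ _] := repr. Qed.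

Lemma reprM a b v : pi (a ** b) v = pi a (pi b v).
Proof. by have [_ _ _ -> _] := repr. Qed.

Lemma repr_star a u v : inner (pi a u) v = inner u (pi (star a) v).
Proof. by have [_ _ _ _ adj] := repr; exact: adj. Qed.

Lemma repr_starr a u v : inner u (pi a v) = inner (pi (star a) u) v.
Proof. by rewrite repr_star starK. Qed.

Definition reprE := (reprD, reprN, reprZ, repr1, reprM).

(** If [a] is a strict contraction then [1 - a^* a] is the square of a
    self-adjoint element, hence is mapped to a positive operator. *)
Lemma repr_contraction a v : nrm a < 1 -> nrm (pi a v) <= nrm v.
Proof.
move=> a1; have [||b bs bb] := @sqrt_one_sub _ _ (star a ** a).
- by rewrite starM starK.
- by rewrite nrm_starM expr_lt1 // nrm_ge0.
have : 0 <= nrm (pi b v) ^+ 2 by rewrite sqr_ge0.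
have -> : nrm (pi b v) ^+ 2 = nrm v ^+ 2 - nrm (pi a v) ^+ 2.
  apply: (@complexI R); rewrite !realcE -!inner_nrm repr_star bs -reprM bb.
  by rewrite !reprE !innerE [inner (pi a v) _]repr_star.
by rewrite subr_ge0 ler_sqr ?nnegrE ?nrm_ge0.
Qed.

Lemma nrm_repr a v : nrm (pi a v) <= nrm a * nrm v.
Proof.
apply/ler_addgt0Pr => e e0.
have v1 : 0 < nrm v + 1 by rewrite ltr_wpDl ?nrm_ge0.
pose s := nrm a + e / (nrm v + 1).
have es : 0 < e / (nrm v + 1) by rewrite divr_gt0.
have s0 : 0 < s by rewrite ltr_wpDl ?nrm_ge0.
have := @repr_contraction ((s^-1)%:C *: a) v.
rewrite reprZ !nrmZ nrm_real gtr0_norm ?invr_gt0 //.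
rewrite ltr_pdivrMl // mulr1 ltrDl => /(_ es).
rewrite ler_pdivrMl // => /le_trans; apply.
rewrite mulrDl lerD2l -mulrA ler_piMr ?(ltW e0) //.
by rewrite mulrC ler_pdivrMr // mul1r lerDl.
Qed.

End RepresentationNorm.

(** * Operators commuting with a rank-one projection *)

Section WeakTopology.
Context {R : realType} {H : hilbertType R}.
Implicit Types (T S : H -> H) (M : set (H -> H)).

Lemma wot_coord_continuous (x y : H) :
  continuous (fun T : @wot R H => inner (T x) y : R[i]^o).
Proof.
move=> T.
pose f := (fun (T : @wot R H) (p : H * H) => inner (T p.1) p.2) :
  @wot R H -> {ptws H * H -> R[i]^o}.
have cf : continuous f by exact: initial_continuous.
apply: (@continuous_comp _ _ _ f (fun g : {ptws H * H -> R[i]^o} => g (x, y))).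
  exact: cf.
exact: (@proj_continuous _ (fun=> R[i]^o) (x, y)).
Qed.

(** Two matrix coefficients at a time suffice, both to test commutation and to
    separate two eigenvalues. *)
Lemma wot_closure_approx M T (x y x' y' : H) (e : R) : wot_closure M T -> 0 < e ->
  exists S, [/\ M S, nrm (inner (T x) y - inner (S x) y) < e &
    nrm (inner (T x') y' - inner (S x') y') < e].
Proof.
move=> [_ clT] e0.
have nb u v : nbhs (T : @wot R H)
    [set S : @wot R H | nrm (inner (T u) v - inner (S u) v) < e].
  have := @wot_coord_continuous u v T.
  move=> /cvgrPdist_lt /(_ e%:C); rewrite ltcR => /(_ e0).
  by apply: filterS => S; rewrite nrmE ltcR.
have [S [MS [S1 S2]]] := clT _ (filterI (nb x y) (nb x' y')).
by exists S.
Qed.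

Lemma wot_closure_refl M : M `<=` bounded_operators -> M `<=` wot_closure M.
Proof. by move=> Mb T MT; split; [exact: Mb|exact: subset_closure]. Qed.

Lemma bounded_operators_manifold : linear_manifold (@bounded_operators R H).
Proof.
apply/linear_manifoldP; split.
  split; first by move=> a x y; rewrite scaler0 addr0.
  by move=> x; exact: cvg_cst.
move=> a T S [linT cT] [linS cS].
have linTS : linear (a *: T + S).
  move=> k x y; rewrite !fctE linT linS !scalerDr !scalerA [a * k]mulrC.
  by rewrite !addrA; congr (_ + _); rewrite -!addrA; congr (_ + _); rewrite addrC.
split => //.
have [K TK] := (linear_continuousP linT).1 cT.
have [L SL] := (linear_continuousP linS).1 cS.
apply/(linear_continuousP linTS); exists (nrm a * K + L) => x.
apply: le_trans (nrmD _ _) _; rewrite mulrDl lerD // nrmZ -mulrA.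
by rewrite ler_wpM2l ?nrm_ge0.
Qed.

Lemma bounded_operators_comp T S : bounded_operators T -> bounded_operators S ->
  bounded_operators (T \o S : H -> H).
Proof.
move=> [linT cT] [linS cS]; split; first by move=> a x y; rewrite /= linS linT.
by move=> x; apply: continuous_comp; [exact: cS|exact: cT].
Qed.

Lemma adjointC T S : adjoint T S -> adjoint S T.
Proof. by move=> TS x y; rewrite innerC -TS -innerC. Qed.

Section Commutant.
Variable F : H -> H.
Hypotheses (bF : bounded_operators F) (FF : adjoint F F).

(** The commutant of a self-adjoint operator; adjoints exist in it by the
    Riesz representation, and commutation is detected by matrix coefficients. *)
Lemma commutant_von_neumann :
  von_neumann_algebra [set T | bounded_operators T /\ T \o F = F \o T].
Proof.
have [linF cF] := bF.
set Z := [set T | _]; split.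
  split; [by move=> T []| |by split => //; split => // x; exact: cvg_id| |].
  - apply/linear_manifoldP; split.
      split; first exact: manifold0 bounded_operators_manifold.
      by apply/funext => x /=; rewrite (lin0 linF).
    move=> a T S [bT TF] [bS SF]; split.
      by have /linear_manifoldP[_] := bounded_operators_manifold; apply.
    apply/funext => x /=; rewrite !fctE linF.
    by rewrite -[F (T x)]/((F \o T) x) -TF -[F (S x)]/((F \o S) x) -SF.
  - move=> T S [bT TF] [bS SF]; split; first exact: bounded_operators_comp.
    by rewrite -compA SF compA TF.
  - move=> T [bT TF]; have [S bS TS] := adjoint_exists bT.
    exists S => //; split => //; apply/funext => x; apply: inner_ext => z /=.
    rewrite (adjointC TS) FF -[F (T z)]/((F \o T) z) -TF /=.
    by rewrite FF (adjointC TS).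
apply/seteqP; split; last by apply: wot_closure_refl => T [].
move=> T ZT; have bT : bounded_operators T by have [] := ZT.
split => //; apply/funext => x; apply: inner_ext => y /=.
apply/eqP; rewrite -subr_eq0; apply/eqP; apply: nrm_eps_eq0 => e e0.
have e2 : 0 < e / 2 by rewrite divr_gt0.
have [S [[_ SF] S1 S2]] := wot_closure_approx (F x) y x (F y) ZT e2.
rewrite FF (splitr e).
apply: le_trans (nrm_triangle (inner (S (F x)) y) _ _) _.
rewrite lerD ?(ltW S1) //.
rewrite -[S (F x)]/((S \o F) x) SF /= FF nrm_sym; exact: ltW.
Qed.

(** The operators [S + U F] with [S] and [U] in [M] form an abelian self-adjoint
    algebra that contains both [M] and [F]. *)
Lemma op_masa_commute (M : set (H -> H)) : op_masa M -> F \o F = F ->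
  (forall T, M T -> T \o F = F \o T) -> M F.
Proof.
move=> [[Mb linM M1 MM Madj] Mab Mmax] F2 MF.
have [linF cF] := bF.
pose N := [set T | exists S U, [/\ M S, M U & T = S + (U \o F)]].
have linop T : M T -> linear T by move=> /Mb[].
have MN : M `<=` N.
  move=> T MT; exists T, 0; split => //; first exact: manifold0.
  by apply/funext => x; rewrite !fctE addr0.
have mul S U S' U' : M S -> M U -> M S' -> M U' ->
    (S + (U \o F)) \o (S' + (U' \o F)) =
    (S \o S') + (((S \o U') + (U \o S') + (U \o U')) \o F).
  move=> MS MU MS' MU'; apply/funext => x; rewrite !fctE /=.
  have FS : F (S' x) = S' (F x) by rewrite -[LHS]/((F \o S') x) -MF.
  have FU : F (U' (F x)) = U' (F x).
    by rewrite -[LHS]/((F \o U') (F x)) -MF //= -[F (F x)]/((F \o F) x) F2.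
  rewrite (linD (linop _ MS)) (linD linF) FS FU (linD (linop _ MU)).
  by rewrite !addrA.
have <- : N = M; last first.
  exists 0, idfun; split => //; first exact: manifold0.
  by apply/funext => x; rewrite !fctE add0r.
apply: Mmax => //.
  split.
  - move=> _ [S [U [MS MU ->]]]; apply: manifoldD.
    + exact: bounded_operators_manifold.
    + exact: Mb.
    + by apply: bounded_operators_comp => //; exact: Mb.
  - apply/linear_manifoldP; split.
      exists 0, 0; split; [exact: manifold0|exact: manifold0|].
      by apply/funext => x; rewrite !fctE addr0.
    move=> a _ _ [S [U [MS MU ->]]] [S' [U' [MS' MU' ->]]].
    exists (a *: S + S'), (a *: U + U'); split.
    + by apply: manifoldD => //; exact: manifoldZ.
    + by apply: manifoldD => //; exact: manifoldZ.
    + by apply/funext => x; rewrite !fctE /= scalerDr addrACA.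
  - exact: MN.
  - move=> _ _ [S [U [MS MU ->]]] [S' [U' [MS' MU' ->]]].
    exists (S \o S'), ((S \o U') + (U \o S') + (U \o U')).
    split; [exact: MM| |exact: mul].
    by do 2?apply: manifoldD => //; exact: MM.
  - move=> _ [S [U [MS MU ->]]].
    have [S' MS' SS'] := Madj _ MS; have [U' MU' UU'] := Madj _ MU.
    exists (S' + (U' \o F)); first by exists S', U'.
    move=> x y; rewrite !fctE innerDl innerDr SS' UU' /= FF.
    by rewrite -[U' (F y)]/((U' \o F) y) (MF _ MU').
move=> _ _ [S [U [MS MU ->]]] [S' [U' [MS' MU' ->]]].
rewrite !mul // (Mab S S') // (Mab U U') // (Mab S U') // (Mab S' U) //.
by rewrite [(U' \o S) + _]addrC.
Qed.

End Commutant.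

End WeakTopology.

(** * The orthonormal basis of a multiplicity free nest *)

Section RankOne.
Context {R : realType} {H : hilbertType R}.
Implicit Types (e x y : H) (V : set H) (T : H -> H).

Definition rank_one e : H -> H := fun x => inner x e *: e.

Lemma rank_one_bounded e : bounded_operators (rank_one e).
Proof.
have lin1 : linear (rank_one e).
  by move=> a x y; rewrite /rank_one !innerE scalerDl scalerA.
split => //; apply/(linear_continuousP lin1); exists (nrm e * nrm e) => x.
rewrite nrmZ mulrAC ler_wpM2r ?nrm_ge0 // [leRHS]mulrC.
exact: cauchy_schwarz.
Qed.

Lemma rank_one_adjoint e : adjoint (rank_one e) (rank_one e).
Proof. by move=> x y; rewrite /rank_one !innerE [inner y e]innerC conjCK mulrC. Qed.

Lemma inner_unit e : nrm e = 1 -> inner e e = 1.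
Proof. by move=> e1; rewrite inner_nrm e1 expr1n. Qed.

Lemma rank_one_idem e : nrm e = 1 -> rank_one e \o rank_one e = rank_one e.
Proof.
by move=> /inner_unit e1; apply/funext => x; rewrite /rank_one /= !innerE e1 mulr1.
Qed.

Lemma normalize_unit x : x != 0 -> nrm (((nrm x)^-1)%:C *: x) = 1.
Proof.
move=> /nrm_gt0 x0.
by rewrite nrmZ nrm_real gtr0_norm ?invr_gt0 // mulVf // gt_eqF.
Qed.

Section OrthogonalProjection.
Variables (V : set H) (T : H -> H).
Hypotheses (linV : linear_manifold V) (TV : orthogonal_projection V T).

Lemma orthogonal_projection_uniq x v : V v ->
  (forall y, V y -> inner (x - v) y = 0) -> T x = v.
Proof.
move=> Vv xv; have [VT xT] := TV x.
have VTv : V (T x - v) by exact: manifoldB.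
apply/eqP; rewrite -subr_eq0; apply/eqP; apply: inner_ext => z.
have : inner (T x - v) (T x - v) = 0.
  have -> : inner (T x - v) (T x - v) =
      inner (x - v) (T x - v) - inner (x - T x) (T x - v).
    by rewrite !innerE; ring.
  by rewrite xv // xT // subrr.
rewrite inner_nrm -realcX => /complexI/eqP; rewrite sqrf_eq0 => /eqP/nrm_eq0 ->.
by rewrite inner0l.
Qed.

Lemma orthogonal_projection_adjoint : adjoint T T.
Proof.
move=> x y; have [VTx xT] := TV x; have [VTy yT] := TV y.
have /eqP := xT _ VTy; rewrite !innerE subr_eq0 => /eqP ->.
have /inner_eq0C/eqP := yT _ VTx; rewrite !innerE subr_eq0 => /eqP ->.
by [].
Qed.

Lemma orthogonal_projection_bounded : bounded_operators T.
Proof.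
have linT : linear T.
  move=> a x y; have [VTx xT] := TV x; have [VTy yT] := TV y.
  apply: orthogonal_projection_uniq.
    by apply: manifoldD => //; exact: manifoldZ.
  move=> z Vz.
  have -> : inner (a *: x + y - (a *: T x + T y)) z =
      a * inner (x - T x) z + inner (y - T y) z by rewrite !innerE; ring.
  by rewrite xT // yT // mulr0 addr0.
split => //; apply/(linear_continuousP linT); exists 1 => x; rewrite mul1r.
have [VT /(_ _ VT)] := TV x => /inner_eq0C /pythagoras.
rewrite addrC subrK => nx; rewrite -ler_sqr ?nnegrE ?nrm_ge0 // nx.
by rewrite lerDl sqr_ge0.
Qed.

Lemma orthogonal_projection_rank_one e :
  V e \/ (forall v, V v -> inner e v = 0) ->
  T \o rank_one e = rank_one e \o T.
Proof.
move=> eV; have [linT _] := orthogonal_projection_bounded.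
apply/funext => x; rewrite /rank_one /= (linZ linT) orthogonal_projection_adjoint.
have [->//|->] : T e = e \/ T e = 0.
  case: eV => [Ve|eV]; [left|right]; apply: orthogonal_projection_uniq => //.
  - by move=> y _; rewrite subrr inner0l.
  - exact: manifold0.
  - by move=> y Vy; rewrite subr0 eV.
by rewrite inner0r scaler0 scale0r.
Qed.

End OrthogonalProjection.

(** The combinatorial content of an order type [-N] multiplicity free nest:
    successive members differ by the lines spanned by the vectors [e n]. *)
Definition nest_basis (P : nat -> set H) (e : nat -> H) :=
  [/\ P 0%N = setT, \bigcap_n P n = [set 0],
      forall n, [/\ closed (P n), linear_manifold (P n) & P n.+1 `<=` P n],
      forall n, [/\ P n (e n), nrm (e n) = 1 &
        forall x, P n.+1 x -> inner (e n) x = 0] &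
      forall n x, P n x -> P n.+1 (x - inner x (e n) *: e n)].

Lemma rank_one_commute_parallel e x : nrm e = 1 -> nrm x = 1 ->
  rank_one e \o rank_one x = rank_one x \o rank_one e -> inner x e != 0 ->
  e = inner e x *: x.
Proof.
move=> /inner_unit e1 /inner_unit x1 /(congr1 (fun f => f x)).
rewrite /rank_one /= x1 scale1r !innerE -scalerA => + xe.
exact: scalerI.
Qed.

End RankOne.

Section NestBasis.
Context {R : realType} {C : cstarAlgType R} {H : hilbertType R}.
Variables (A : set C) (pi : C -> H -> H).

(** The rank-one projection on a unit vector of the layer between [P n] and
    [P n.+1] commutes with the projections of the nest, hence with the von
    Neumann algebra [W] that they generate, hence belongs to [W], which is a
    masa.  As [W] is abelian, two such vectors are parallel or orthogonal, which
    forces the layer to be a line. *)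
Lemma nest_basis_exists :
  has_order_type_negN pi A -> multiplicity_free pi A ->
  exists P e, nest_basis P e /\ Lat pi A = [set [set 0]] `|` range P.
Proof.
move=> [P [P0 Plt Pcap LatP]]; rewrite /multiplicity_free /multiplicity_free_nest.
set W := generated_von_neumann_algebra _ => masaW.
have latP n : Lat pi A (P n) by rewrite LatP; right; exists n.
have closedP n : closed (P n) by have [] := latP n.
have linP n : linear_manifold (P n) by have [] := latP n.
have sub n : P n.+1 `<=` P n by have [] := Plt n.
have subn m n : (m <= n)%N -> P n `<=` P m.
  move=> /subnKC <-; elim: (n - m)%N => [|k IHk]; first by rewrite addn0.
  by rewrite addnS; apply: subset_trans IHk.
have WF n x : nrm x = 1 -> P n x -> (forall v, P n.+1 v -> inner x v = 0) ->
    W (rank_one x).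
  move=> x1 Pnx xP; have bF := rank_one_bounded x; have aF := rank_one_adjoint x.
  apply: op_masa_commute => //; first exact: rank_one_idem.
  move=> T WT; suff [] : bounded_operators T /\ T \o rank_one x = rank_one x \o T by [].
  apply: (WT [set T | bounded_operators T /\ T \o rank_one x = rank_one x \o T]).
  split; first exact: commutant_von_neumann.
  move=> S [V LV SV]; have linV : linear_manifold V by have [] := LV.
  split; first exact: orthogonal_projection_bounded SV.
  apply: (orthogonal_projection_rank_one linV SV).
  move: LV; rewrite LatP => -[->|[m _ <-]].
    by right=> v ->; rewrite inner0r.
  case: (leqP m n) => mn; first by left; exact: subn Pnx.
  by right=> v Pmv; apply: xP; exact: subn Pmv.
have Wab : op_abelian W by case: masaW.
have /choice[e eP] n : exists e, [/\ P n e, nrm e = 1 &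
    forall x, P n.+1 x -> inner e x = 0].
  have [_ /nonsubset[x [Pnx /= nPx]]] := Plt n.
  have [p [Pp xp]] := projection_exists x (closedP n.+1) (linP n.+1).
  have xp0 : x - p != 0.
    by apply/eqP => /eqP; rewrite subr_eq0 => /eqP xp0; apply: nPx; rewrite xp0.
  exists (((nrm (x - p))^-1)%:C *: (x - p)); split.
  - by apply: manifoldZ => //; apply: manifoldB => //; exact: sub.
  - exact: normalize_unit.
  - by move=> y Py; rewrite innerZl xp // mulr0.
exists P, e; split => //; split => // n x Pnx; have [Pe e1 eP1] := eP n.
have ee := inner_unit e1.
have [p [Pp xp]] := projection_exists x (closedP n.+1) (linP n.+1).
have xe : inner x (e n) = inner (x - p) (e n).
  by rewrite innerDl innerNl [inner p _]innerC eP1 // conjC0 subr0.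
pose z := x - p - inner (x - p) (e n) *: e n.
suff z0 : z = 0.
  suff -> : x - inner x (e n) *: e n = p by [].
  by move/eqP: z0; rewrite /z -xe subr_eq0 subr_eq addrC -subr_eq => /eqP.
have Pz : P n z.
  by apply: manifoldB; [|apply: manifoldB => //; exact: sub|exact: manifoldZ].
have zP v : P n.+1 v -> inner z v = 0.
  by move=> Pv; rewrite /z innerDl innerNl innerZl xp // eP1 // mulr0 subrr.
have ze : inner (e n) z = 0.
  by apply: inner_eq0C; rewrite /z innerDl innerNl innerZl ee mulr1 subrr.
(* A unit vector of the same layer that is not orthogonal to [e n] is parallel
   to it, so the sum [e n + z] cannot have a component along [z]. *)
apply/eqP; apply: contraT => z0.
have ez0 : e n + z != 0.
  apply/eqP => ez; have : inner (e n) (e n + z) = 0 by rewrite ez inner0r.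
  by rewrite innerDr ee ze addr0 => /eqP; rewrite oner_eq0.
pose x' := ((nrm (e n + z))^-1)%:C *: (e n + z).
have x'1 : nrm x' = 1 by exact: normalize_unit.
have We : W (rank_one (e n)) by exact: (WF n).
have Wx : W (rank_one x').
  apply: (WF n) x'1 _ _; first by apply: manifoldZ => //; exact: manifoldD.
  by move=> v Pv; rewrite /x' innerZl innerDl eP1 // zP // addr0 mulr0.
have nz : ((nrm (e n + z))^-1)%:C != 0 :> R[i].
  by rewrite (inj_eq (@complexI R) _ 0) invr_eq0 gt_eqF // nrm_gt0.
have ze' : inner z (e n) = 0 by exact: inner_eq0C.
have x'e : inner x' (e n) != 0.
  by rewrite /x' innerZl innerDl ee ze' addr0 mulr1.
have ex := rank_one_commute_parallel e1 x'1 (Wab _ _ We Wx) x'e.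
have : inner (e n) z = 0 by [].
rewrite ex innerZl /x' innerZl innerDl ze add0r => /eqP.
rewrite mulf_eq0 mulf_eq0 (negPf nz) inner_nrm expf_eq0 /=.
rewrite (inj_eq (@complexI R) _ 0) (gt_eqF (nrm_gt0 z0)) !orbF.
by rewrite innerC conjC_eq0 (negPf x'e).
Qed.

End NestBasis.

Section NestBasisTheory.
Context {R : realType} {H : hilbertType R}.
Variables (P : nat -> set H) (e : nat -> H).
Hypothesis basis : nest_basis P e.

Lemma basis_manifold n : linear_manifold (P n).
Proof. by have [_ _ /(_ n)[]] := basis. Qed.

Lemma basis_closed n : closed (P n).
Proof. by have [_ _ /(_ n)[]] := basis. Qed.

Lemma basis_sub m n : (m <= n)%N -> P n `<=` P m.
Proof.
move=> /subnKC <-; elim: (n - m)%N => [|k IHk]; first by rewrite addn0.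
by rewrite addnS; apply: subset_trans IHk; have [_ _ /(_ (m + k)%N)[]] := basis.
Qed.

Lemma basis_mem n : P n (e n).
Proof. by have [_ _ _ /(_ n)[]] := basis. Qed.

Lemma basis_nrm n : nrm (e n) = 1.
Proof. by have [_ _ _ /(_ n)[]] := basis. Qed.

Lemma basis_inner n : inner (e n) (e n) = 1.
Proof. by rewrite inner_unit // basis_nrm. Qed.

Lemma basis_perp m n x : (m < n)%N -> P n x -> inner (e m) x = 0.
Proof.
by move=> mn Pnx; have [_ _ _ /(_ m)[_ _ +] _] := basis; apply; exact: basis_sub Pnx.
Qed.

Lemma basis_orth m n : m != n -> inner (e m) (e n) = 0.
Proof.
rewrite neq_ltn => /orP[mn|mn]; first exact: basis_perp (basis_mem n).
by apply: inner_eq0C; exact: basis_perp (basis_mem m).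
Qed.

Lemma basis_split n x : P n x -> P n.+1 (x - inner x (e n) *: e n).
Proof. by have [_ _ _ _] := basis; exact. Qed.

Lemma basis_span_perp n x : (forall k, (k < n)%N -> inner x (e k) = 0) ->
  (forall y, P n y -> inner x y = 0) -> x = 0.
Proof.
move=> xe xP; apply: inner_ext => z; rewrite inner0l.
suff : forall m, (m <= n)%N -> forall z, P (n - m)%N z -> inner x z = 0.
  by move=> /(_ n (leqnn n)); apply; rewrite subnn; have [->] := basis.
elim=> [|m IHm] mn {}z; first by rewrite subn0; exact: xP.
move=> Pz; have := basis_split Pz; rewrite -subSn // subSS => Pz'.
rewrite -[z](subrK (inner z (e (n - m.+1)%N) *: e (n - m.+1)%N)) innerDr.
by rewrite (IHm (ltnW mn) _ Pz') innerZr xe ?mulr0 ?addr0 //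
  subnS prednK ?subn_gt0 // leq_subr.
Qed.

Lemma basis_expand N y : (forall v, P N v -> inner y v = 0) ->
  y = \sum_(k <- iota 0 N) inner y (e k) *: e k.
Proof.
move=> yN; apply/eqP; rewrite -subr_eq0; apply/eqP.
apply: (@basis_span_perp N) => [k kN|v Pv].
  rewrite innerDl innerNl inner_suml (bigD1_seq k) ?mem_iota ?iota_uniq //=.
  rewrite innerZl basis_inner mulr1 big1 ?addr0 ?subrr // => j jk.
  by rewrite innerZl basis_orth // mulr0.
rewrite innerDl innerNl inner_suml yN // sub0r big_seq big1 ?oppr0 // => k.
by rewrite mem_iota add0n => kN; rewrite innerZl (basis_perp kN) // mulr0.
Qed.

Lemma basis_sum_le n N y (F : nat -> H) (d : R) : P n y ->
  (forall k, (n <= k < N)%N -> nrm (F k) <= d) ->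
  nrm (\sum_(k <- iota 0 N) inner y (e k) *: F k) <=
  (\sum_(k <- iota 0 N) nrm (inner y (e k))) * d.
Proof.
move=> Py Fd; apply: le_trans (nrm_sum _ _) _; rewrite mulr_suml.
rewrite big_seq [leRHS]big_seq; apply: ler_sum => k.
rewrite mem_iota add0n => kN; rewrite nrmZ.
have [nk|kn] := leqP n k; first by rewrite ler_wpM2l ?nrm_ge0 // Fd // nk.
by rewrite (inner_eq0C (basis_perp kn Py)) nrm0 !mul0r.
Qed.

(** The projection of [x] to the closed span of the finitely supported vectors
    differs from [x] by a vector that lies in every member of the nest. *)
Lemma basis_dense n x (eps : R) : P n x -> 0 < eps -> exists N y,
  [/\ P n y, forall v, P N v -> inner y v = 0 & nrm (x - y) < eps].
Proof.
move=> Pnx eps0.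
pose U := [set y | P n y /\ exists N, forall v, P N v -> inner y v = 0].
have linU : linear_manifold U.
  apply/linear_manifoldP; split.
    by split; [exact: manifold0 (basis_manifold n)|exists 0%N => v _; rewrite inner0l].
  move=> a u v [Pu [N uN]] [Pv [N' vN]]; split.
    apply: (manifoldD (basis_manifold n)) => //.
    exact: (manifoldZ (basis_manifold n)).
  exists (maxn N N') => w Pw; rewrite innerDl innerZl.
  rewrite uN; last exact: basis_sub (leq_maxl _ _) _ Pw.
  by rewrite vN ?mulr0 ?addr0 //; exact: basis_sub (leq_maxr _ _) _ Pw.
have [p [clUp xp]] := projection_exists x (@closed_closure _ U) (closure_manifold linU).
have Pp : P n p.
  by apply: (@basis_closed n p); apply: closure_subset clUp => u [].
have Pxp : P n (x - p) by exact: (manifoldB (basis_manifold n)).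
have xp_all m : P (n + m)%N (x - p).
  elim: m => [|m IHm]; first by rewrite addn0.
  rewrite addnS; have := basis_split IHm; rewrite xp ?scale0r ?subr0 //.
  apply: subset_closure; split; first exact: basis_sub (leq_addr _ _) _ (basis_mem _).
  by exists (n + m).+1 => v; exact: basis_perp.
have xp0 : x - p = 0.
  have : (\bigcap_m P m) (x - p).
    by move=> m _; apply: basis_sub (xp_all m); exact: leq_addl.
  by have [_ -> _ _ _] := basis.
move/eqP: xp0; rewrite subr_eq0 => /eqP xp0.
have [u [Pu [N uN]] xu] := (closure_nrm _ _).1 clUp _ eps0.
by exists N, u; split => //; rewrite xp0.
Qed.

End NestBasisTheory.

(** * Diagonal elements separate the basis *)

Section Diagonal.
Context {R : realType} {C : cstarAlgType R} {H : hilbertType R}.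
Variables (A : set C) (pi : C -> H -> H).
Variables (P : nat -> set H) (e : nat -> H).
Hypotheses (algA : subalgebra A) (repr : star_representation pi).
Hypotheses (basis : nest_basis P e).
Hypothesis latP : Lat pi A = [set [set 0]] `|` range P.
Hypothesis masa_pi : masa_preserving pi A.
Local Notation D := (Defs.diagonal A).

Lemma nest_invariant n a x : A a -> P n x -> P n (pi a x).
Proof.
have : Lat pi A (P n) by rewrite latP; right; exists n.
by case=> _ _; apply.
Qed.

Lemma diagonal_star d : D d -> D (star d).
Proof. by move=> [Ad [b Ab bd]]; split; [rewrite -bd starK|exists d]. Qed.

Lemma diagonalE d : D d <-> A d /\ A (star d).
Proof.
split=> [Dd|[Ad Asd]]; first by split; [case: Dd|have [] := diagonal_star Dd].
by split => //; exists (star d); rewrite // starK.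
Qed.

Lemma diagonal_manifold : linear_manifold D.
Proof.
have [linA _ _] := algA; apply/linear_manifoldP; split.
  by apply/diagonalE; rewrite star0; split; exact: manifold0.
move=> k x y /diagonalE[Ax Asx] /diagonalE[Ay Asy]; apply/diagonalE.
by rewrite starD starZ; split; apply: manifoldD => //; exact: manifoldZ.
Qed.

Lemma diagonal1 : D aone.
Proof. by have [_ A1 _] := algA; apply/diagonalE; rewrite star1. Qed.

Lemma diagonalM x y : D x -> D y -> D (x ** y).
Proof.
have [_ _ AM] := algA; move=> /diagonalE[Ax Asx] /diagonalE[Ay Asy].
by apply/diagonalE; rewrite starM; split; exact: AM.
Qed.

Definition diag_coef d n := inner (pi d (e n)) (e n).

Lemma diagonal_eigen d n : D d -> pi d (e n) = diag_coef d n *: e n.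
Proof.
move=> /diagonalE[Ad Asd]; apply/eqP; rewrite -subr_eq0; apply/eqP.
have Pd : P n (pi d (e n)) by apply: nest_invariant => //; exact: basis_mem basis n.
have Pz := basis_split basis Pd; apply: nrm_eq0; apply/eqP; rewrite -sqrf_eq0.
apply/eqP; apply: (@complexI R); rewrite realcX -inner_nrm.
rewrite innerDl innerNl innerZl (basis_perp basis (ltnSn n) Pz) mulr0 subr0.
by rewrite repr_star // (basis_perp basis (ltnSn n)) //; exact: nest_invariant.
Qed.

Lemma diag_coef_star d n : diag_coef (star d) n = Num.conj (diag_coef d n).
Proof. by rewrite /diag_coef -repr_starr // innerC. Qed.

(** As [e n] is an eigenvector of all diagonal elements, its projection commutes
    with the masa in which the image of the diagonal is weakly dense. *)
Lemma rank_one_wot_closure n : wot_closure (pi @` D) (rank_one (e n)).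
Proof.
have [M [masaM _ Mcl]] := masa_pi.
have bF := rank_one_bounded (e n); have aF := rank_one_adjoint (e n).
apply: (Mcl); apply: op_masa_commute => //.
  by apply: rank_one_idem; exact: basis_nrm basis n.
have [_ vnZ] := commutant_von_neumann bF aF.
move=> T /Mcl [bT clT].
suff [] : bounded_operators T /\ T \o rank_one (e n) = rank_one (e n) \o T by [].
move: vnZ; set Z := [set T | _] => vnZ; suff : Z T by [].
rewrite -vnZ; split => //; apply: closure_subset clT => _ [d Dd <-].
have [bpi _ _ _ _] := repr; split => //; apply/funext => x.
rewrite /rank_one /= (linZ (repr_linear repr d)) (diagonal_eigen n Dd).
rewrite repr_star // (diagonal_eigen n (diagonal_star Dd)) innerZr.
by rewrite diag_coef_star conjCK scalerA mulrC.
Qed.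

(** A diagonal element weakly close to the projection on [e j] has distinct
    eigenvalues at [e j] and [e k]; an affine function of it takes the values
    [1] and [0] there. *)
Lemma diagonal_separates j k : j != k ->
  exists d, [/\ D d, pi d (e j) = e j & pi d (e k) = 0].
Proof.
move=> jk; have h0 : 0 < (2^-1 : R) by rewrite invr_gt0.
have [_ [[d Dd <-] dj dk]] :=
  wot_closure_approx (e j) (e j) (e k) (e k) (rank_one_wot_closure j) h0.
move: dj dk; rewrite /rank_one !innerE (basis_inner basis) mulr1.
rewrite [inner (e k) _](basis_orth basis) 1?eq_sym // mul0r sub0r nrmN.
rewrite -/(diag_coef d j) -/(diag_coef d k); set a := diag_coef d j.
set b := diag_coef d k => dj dk.
have ab0 : a - b != 0.
  apply/eqP => ab; suff : nrm (1 : R[i]) < 1 by rewrite nrm1 ltxx.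
  have -> : 1 = (1 - a) + b + (a - b) by ring.
  by rewrite ab addr0; have := nrmD (1 - a) b; lra.
exists ((a - b)^-1 *: (d - b *: aone)); split.
- apply: (manifoldZ diagonal_manifold); apply: (manifoldB diagonal_manifold) => //.
  by apply: (manifoldZ diagonal_manifold); exact: diagonal1.
- rewrite !(reprE repr) (diagonal_eigen j Dd) -/a -scalerBl scalerA mulVf //.
  by rewrite scale1r.
- by rewrite !(reprE repr) (diagonal_eigen k Dd) -/b subrr scaler0.
Qed.

(** Products of separating elements interpolate exactly, without any control of
    their norms. *)
Lemma diagonal_unit n N : exists d, [/\ D d, pi d (e n) = e n &
  forall k, (k < N)%N -> k != n -> pi d (e k) = 0].
Proof.
elim: N => [|N [d [Dd dn dk]]].
  by exists aone; split=> [||//]; [exact: diagonal1|rewrite (repr1 repr)].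
have [nN|nN] := eqVneq n N.
  exists d; split => // k; rewrite ltnS leq_eqVlt => /orP[/eqP -> | /dk //].
  by rewrite nN eqxx.
have [d' [Dd' d'n d'N]] := diagonal_separates nN.
exists (d' ** d); split; first exact: diagonalM.
  by rewrite (reprM repr) dn.
have lin := repr_linear repr d'.
move=> k; rewrite ltnS leq_eqVlt (reprM repr) => /orP[/eqP -> _|kN kn].
  by rewrite (diagonal_eigen N Dd) (linZ lin) d'N scaler0.
by rewrite dk // (lin0 lin).
Qed.

Lemma diagonal_interpolation N (t : nat -> R) : exists d, [/\ D d, star d = d &
  forall k, (k < N)%N -> pi d (e k) = (t k)%:C *: e k].
Proof.
have /choice[q qP] n := diagonal_unit n N.
pose d := \sum_(n <- iota 0 N) (t n)%:C *: q n.
have Dd : D d.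
  apply: (manifold_sum diagonal_manifold) => n _.
  by apply: (manifoldZ diagonal_manifold); have [] := qP n.
have lpi x : linear (fun a => pi a x).
  by have [_ lpi _ _ _] := repr; move=> a u v; rewrite lpi.
have dk k : (k < N)%N -> pi d (e k) = (t k)%:C *: e k.
  move=> kN; rewrite (lin_sum (lpi (e k))).
  rewrite (bigD1_seq k) ?mem_iota ?iota_uniq //= big1_seq ?addr0; last first.
    move=> n /andP[nk _]; rewrite (reprZ repr); have [_ _ ->] := qP n => //.
      by rewrite scaler0.
    by rewrite eq_sym.
  by rewrite (reprZ repr); have [_ -> _] := qP k.
have dks k : (k < N)%N -> pi (star d) (e k) = (t k)%:C *: e k.
  move=> kN; rewrite (diagonal_eigen k (diagonal_star Dd)) diag_coef_star.
  by rewrite /diag_coef dk // innerZl (basis_inner basis) mulr1 conj_realc.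
exists ((2^-1 : R[i]) *: (d + star d)); split.
- apply: (manifoldZ diagonal_manifold); apply: (manifoldD diagonal_manifold) => //.
  exact: diagonal_star.
- by rewrite starZ starD starK addrC fmorphV rmorph_nat.
- move=> k kN; rewrite (reprZ repr) (reprD repr) dk // dks //.
  by rewrite scalerDr -scalerDl (_ : 2^-1 + 2^-1 = 1) ?scale1r //; field.
Qed.

End Diagonal.

(** * Self-adjoint contractions and accretive elements *)

Section RealParts.
Context {R : realType} {C : cstarAlgType R}.
Implicit Types (a h r : C).

(** For small [t] the bound on [1 - t (a + star a)] passes to [1 - t a], because
    [nrm_one_sub] differs from it by a term of order [t ^ 2] only. *)
Lemma accretive_inverse_real_part (B : set C) a (t0 : R) :
  closed B -> subalgebra B -> B a -> 0 < t0 ->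
  (forall t, 0 < t <= t0 -> nrm (aone - t%:C *: (a + star a)) <= 1 + t / 2) ->
  exists g, [/\ B g, g ** (aone + a) = aone, (aone + a) ** g = aone &
    nrm g <= 2].
Proof.
move=> clB algB Ba t00 re.
pose t1 := (2 * (nrm a ^+ 2 + 1))^-1.
have n1 : 0 < 2 * (nrm a ^+ 2 + 1) by rewrite mulr_gt0 // ltr_wpDl ?sqr_ge0.
pose t := Num.min t0 t1.
have t_gt0 : 0 < t by rewrite lt_min t00 invr_gt0.
have tn : t * (2 * (nrm a ^+ 2 + 1)) <= 1.
  by rewrite -ler_pdivlMr // mul1r ge_min lexx orbT.
have := nrm_one_sub a (ltW t_gt0); have := re t.
rewrite t_gt0 ge_min lexx => /(_ isT) ret sq.
apply: (accretive_inverse clB algB Ba t_gt0).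
have t2 : 0 <= 1 + t / 2 by rewrite addr_ge0 // divr_ge0 // ltW.
rewrite -ler_sqr ?nnegrE ?nrm_ge0 //.
have := sqr_ge0 (nrm a); nra.
Qed.

End RealParts.

Section CayleyTransform.
Context {R : realType} {C : cstarAlgType R} {H : hilbertType R}.
Variable pi : C -> H -> H.
Hypothesis repr : star_representation pi.
Local Notation I := ('i : R[i]).

Lemma conj_i : Num.conj I = - I.
Proof. by apply/eqP; rewrite eq_complex /= oppr0 !eqxx. Qed.

Lemma conjN (k : R[i]) : Num.conj (- k) = - Num.conj k.
Proof. exact: (rmorphN Num.conj). Qed.

Lemma mul_ii : I * I = -1.
Proof. by rewrite -expr2 sqr_i. Qed.

(** The self-adjoint element [r = i ((1 + i h)^-1 - (1 - i h)^-1)], that is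
    [2 h / (1 + h^2)], is bounded independently of [h].  It agrees with an
    operator [T] with [T^3 = T] wherever [h] does; here [v1] and [v2] stand for
    [T v0] and [T^2 v0]. *)
Lemma bounded_real_transform (h : C) : star h = h ->
  exists r, [/\ star r = r, nrm r <= 4 & forall v0 v1 v2 (eps : R),
    nrm (pi h v0 - v1) <= eps -> nrm (pi h v1 - v2) <= eps ->
    nrm (pi h v2 - v1) <= eps -> nrm (pi r v0 - v1) <= 8 * eps].
Proof.
move=> hs.
have algT : subalgebra [set: C] by split => //; apply/linear_manifoldP; split.
have [||t /andP[t0 _]|g [_ gl gr g2]] :=
    @accretive_inverse_real_part R C setT (- I *: h) 1 closedT algT.
- by [].
- by [].
- rewrite starZ hs conjN conj_i opprK scaleNr addNr.
  rewrite scaler0 subr0; apply: le_trans nrm_aone _.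
  by rewrite lerDl divr_ge0 // ltW.
exists (I *: (star g - g)); split.
- rewrite starZ starD starN starK conj_i scaleNr -scalerN opprB.
  by [].
- rewrite nrmZ nrmi mul1r; apply: le_trans (nrmB _ _) _.
  by rewrite nrm_star; lra.
move=> v0 v1 v2 eps e0 e1 e2.
have solve (g' : C) (k : R[i]) : nrm k = 1 -> k * k = -1 -> nrm g' <= 2 ->
    g' ** (aone - k *: h) = aone ->
    nrm (pi g' v0 - (v0 + (k / 2) *: v1 - 2^-1 *: v2)) <= 4 * eps.
  move=> k1 kk g'2 gh.
  (* [w] is [(1 - k T)^-1 v0], computed from [T^3 = T] and [k^2 = -1]. *)
  set w := v0 + _ - _.
  have -> : pi g' v0 - w = pi g' (v0 - pi (aone - k *: h) w).
    by rewrite (linB (repr_linear repr g')) -(reprM repr) gh (repr1 repr).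
  have -> : v0 - pi (aone - k *: h) w = k *: (pi h v0 - v1) -
      (2^-1 : R[i]) *: (pi h v1 - v2) - (k / 2) *: (pi h v2 - v1).
    rewrite !(reprE repr) /w.
    have lin := repr_linear repr h.
    rewrite (linB lin) (linD lin) !(linZ lin).
    apply: inner_ext => z; rewrite !innerE.
    by field: kk.
  apply: le_trans (nrm_repr repr _ _) _.
  set u := _ - _ - _; suff : nrm u <= 2 * eps.
    by move=> u2; have := nrm_ge0 g'; have := nrm_ge0 u; nra.
  have n2 : nrm (2^-1 : R[i]) = 2^-1.
    by rewrite nrmV nrm_nat.
  apply: le_trans (nrmB _ _) _.
  have := nrmB (k *: (pi h v0 - v1)) ((2^-1 : R[i]) *: (pi h v1 - v2)).
  rewrite !nrmZ nrmM k1 n2; lra.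
have g1 : nrm (star g) <= 2 by rewrite nrm_star.
have gs : star g ** (aone - (- I) *: h) = aone.
  have := congr1 star gr; rewrite starM starD starZ star1 hs conjN conj_i opprK.
  by rewrite scaleNr opprK.
have gl' : g ** (aone - I *: h) = aone by move: gl; rewrite scaleNr.
have s1 := solve g I nrmi mul_ii g2 gl'.
have s2 : nrm _ <= _ := solve (star g) (- I) _ _ g1 gs.
have -> : pi (I *: (star g - g)) v0 - v1 =
   I *: (pi (star g) v0 - (v0 + (- I / 2) *: v1 - (2^-1 : R[i]) *: v2)) -
   I *: (pi g v0 - (v0 + (I / 2) *: v1 - (2^-1 : R[i]) *: v2)).
  rewrite !(reprE repr); apply: inner_ext => z; rewrite !innerE.
  by field: mul_ii.
apply: le_trans (nrmB _ _) _; rewrite !nrmZ nrmi !mul1r.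
have := s2; rewrite nrmN nrmi mulrNN mul_ii => /(_ erefl erefl).
lra.
Qed.

End CayleyTransform.

(** * Bounded transitivity of the triangular algebra *)

Section Transitivity.
Context {R : realType} {C : cstarAlgType R} {H : hilbertType R}.
Variables (A : set C) (pi : C -> H -> H).
Variables (P : nat -> set H) (e : nat -> H).
Hypotheses (clA : closed A) (algA : subalgebra A).
Hypothesis densA : closure [set x + y | x in A & y in (star @` A : set C)] = setT.
Hypotheses (repr : star_representation pi) (masa_pi : masa_preserving pi A).
Hypotheses (basis : nest_basis P e).
Hypothesis latP : Lat pi A = [set [set 0]] `|` range P.
Local Notation I := ('i : R[i]).

Let linP n : linear_manifold (P n) := basis_manifold basis n.
Let linA : linear_manifold A := subalgebra_manifold algA.
Let invP n a x := @nest_invariant R C H A pi P latP n a x.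

Lemma star_perp n a x v : A a -> (forall w, P n w -> inner x w = 0) -> P n v ->
  inner (pi (star a) x) v = 0.
Proof. by move=> Aa xP Pv; rewrite (repr_star repr) starK xP //; exact: invP. Qed.

(** The closure of the orbit is a member of the nest, and [P n] is the
    smallest one that contains [x]. *)
Lemma orbit_dense n x y (eps : R) : P n x -> ~ P n.+1 x -> P n y -> 0 < eps ->
  exists2 a, A a & nrm (pi a x - y) < eps.
Proof.
move=> Pnx nPx Pny eps0.
have [_ A1 AM] := algA.
pose O := [set pi a x | a in A].
have Ox : O x by exists aone => //; rewrite (repr1 repr).
have linO : linear_manifold O.
  apply/linear_manifoldP; split.
    exists 0; first exact: manifold0.
    by rewrite -(scale0r (aone : C)) (reprZ repr) scale0r.
  move=> k _ _ [a Aa <-] [b Ab <-]; exists (k *: a + b); last by rewrite !(reprE repr).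
  by apply: manifoldD => //; exact: manifoldZ.
have latO : Lat pi A (closure O).
  split; [exact: closed_closure|exact: closure_manifold|].
  move=> a v Aa /closure_nrm clv; apply/closure_nrm => e' e0.
  have a1 : 0 < nrm a + 1 by rewrite ltr_wpDl ?nrm_ge0.
  have [|_ [b Ab <-] vb] := clv (e' / (nrm a + 1)); first by rewrite divr_gt0.
  exists (pi (a ** b) x); first by exists (a ** b) => //; exact: AM.
  rewrite (reprM repr) -(linB (repr_linear repr a)).
  apply: le_lt_trans (nrm_repr repr _ _) _; move: vb; rewrite ltr_pdivlMr //.
  by have := nrm_ge0 (v - pi b x); nra.
suff clOy : closure O y.
  have [_ [a Aa <-] ya] := (closure_nrm _ _).1 clOy _ eps0.
  by exists a => //; rewrite nrm_sym.
have clOx : closure O x by exact: subset_closure.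
move: latO clOx; rewrite latP => -[->|[m _ <-] Pmx].
  by move=> x0; case: nPx; rewrite x0; exact: manifold0.
case: (leqP m n) => mn; first exact: (basis_sub basis mn).
by case: nPx; exact: (basis_sub basis mn).
Qed.

(** For a unit vector [y] orthogonal to [e n], this operator exchanges [e n] and
    [y] and kills the vectors orthogonal to both, so it equals its cube, as
    [bounded_real_transform] requires. *)
Definition swap n (y v : H) := inner v (e n) *: y + inner v y *: e n.

(** Take [b] in [A] sending [e n] close to [y], and let the diagonal element [d]
    fix [e n] and kill the other [e k] with [k < N].  The adjoint of [b ** d] is
    upper triangular, so on [e j] with [j < N] only coefficients along
    [e k] with [k <= j] occur; these are known, and there is no tail to control.
    Hence [b ** d] plus its adjoint is close to [swap n y]. *)
Lemma approximate_swap n N y (eps : R) : (n < N)%N -> P n.+1 y -> 0 < eps ->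
  exists2 h, star h = h & forall j, (n <= j < N)%N ->
    nrm (pi h (e j) - swap n y (e j)) <= eps.
Proof.
move=> nN Py eps0; have eps2 : 0 < eps / 2 by rewrite divr_gt0.
have nPe : ~ P n.+1 (e n).
  move=> /(basis_perp basis (ltnSn n)); rewrite (basis_inner basis) => /eqP.
  by rewrite oner_eq0.
have Pny : P n y by exact: (basis_sub basis (leqnSn n)).
have [b Ab yb] := orbit_dense (basis_mem basis n) nPe Pny eps2.
have [d [/(diagonalE A)[Ad _] dn dk]] := diagonal_unit algA repr basis latP masa_pi n N.
have [_ _ AM] := algA.
pose a := b ** d; have Aa : A a by exact: AM.
have aE k : (k < N)%N -> pi a (e k) = inner (e k) (e n) *: pi b (e n).
  move=> kN; have [->|kn] := eqVneq k n.
    by rewrite (reprM repr) dn (basis_inner basis) scale1r.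
  by rewrite (reprM repr) dk // (lin0 (repr_linear repr b)) (basis_orth basis) // scale0r.
have asE j : (n <= j < N)%N -> pi (star a) (e j) = inner (e j) (pi b (e n)) *: e n.
  move=> /andP[nj jN]; apply/eqP; rewrite -subr_eq0; apply/eqP.
  apply: (basis_span_perp basis (n := j.+1)) => [k kj|v Pv].
    rewrite innerDl innerNl innerZl (repr_star repr) starK aE ?(leq_trans kj) //.
    rewrite innerZr -innerC; have [->|kn] := eqVneq n k; last first.
      by rewrite (basis_orth basis) // !(mul0r, mulr0) subrr.
    by rewrite (basis_inner basis) mul1r mulr1 subrr.
  rewrite innerDl innerNl innerZl (star_perp Aa _ Pv); last first.
    by move=> w; exact: basis_perp.
  by rewrite (basis_perp basis _ Pv) ?mulr0 ?subrr.
exists (a + star a); first by rewrite starD starK addrC.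
move=> j njN; have /andP[nj jN] := njN.
have -> : pi (a + star a) (e j) - swap n y (e j) =
    inner (e j) (e n) *: (pi b (e n) - y) + inner (e j) (pi b (e n) - y) *: e n.
  rewrite (reprD repr) aE // asE // /swap; apply: inner_ext => z; rewrite !innerE.
  by ring.
apply: le_trans (nrmD _ _) _; rewrite !nrmZ (basis_nrm basis) mulr1.
have := cauchy_schwarz (e j) (e n); have := cauchy_schwarz (e j) (pi b (e n) - y).
rewrite !(basis_nrm basis) mul1r; have := nrm_ge0 (pi b (e n) - y); nra.
Qed.

(** The self-adjoint element obtained from [approximate_swap] need not be
    bounded; the transform [2 h / (1 + h^2)] is, and it fixes [swap n y]. *)
Lemma bounded_swap n N y (eps : R) : (n < N)%N -> P n.+1 y -> nrm y = 1 ->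
  (forall v, P N v -> inner y v = 0) -> 0 < eps ->
  exists r, [/\ star r = r, nrm r <= 4 & forall j, (n <= j < N)%N ->
    nrm (pi r (e j) - swap n y (e j)) <= eps].
Proof.
move=> nN Py y1 yN eps0.
pose s := \sum_(k <- iota 0 N) nrm (inner y (e k)).
have s0 : 0 <= s by apply: sumr_ge0 => k _; exact: nrm_ge0.
pose eps1 := eps / 8; have eps10 : 0 < eps1 by rewrite divr_gt0.
have s1 : 0 < 1 + s by rewrite ltr_wpDr.
pose eps2 := eps1 / (1 + s); have eps20 : 0 < eps2 by rewrite divr_gt0.
have eps21 : eps2 <= eps1 by rewrite ler_pdivrMr // ler_peMr ?(ltW eps10) // lerDl.
have [h hs hP] := approximate_swap nN Py eps20.
have [r [rs r4 rP]] := bounded_real_transform repr hs.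
exists r; split => // j njN.
have Pny : P n y by exact: (basis_sub basis (leqnSn n)).
have yn : inner y (e n) = 0 by apply: inner_eq0C; exact: (basis_perp basis (ltnSn n) Py).
have en : swap n y (e n) = y.
  rewrite /swap (basis_inner basis) scale1r (basis_perp basis (ltnSn n) Py).
  by rewrite scale0r addr0.
have hen : nrm (pi h (e n) - y) <= eps1.
  by have := hP n; rewrite leqnn nN en => /(_ isT) /le_trans; apply.
have hy : nrm (pi h y - e n) <= eps1.
  have linh := repr_linear repr h.
  have -> : pi h y - e n =
      \sum_(k <- iota 0 N) inner y (e k) *: (pi h (e k) - swap n y (e k)).
    have -> : e n = swap n y y.
      by rewrite /swap yn scale0r add0r (inner_unit y1) scale1r.
    have lins : linear (swap n y).
      move=> k u v; rewrite /swap; apply: inner_ext => z; rewrite !innerE; ring.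
    under eq_bigr do rewrite scalerBr -(linZ linh) -(linZ lins).
    by rewrite sumrB -(lin_sum linh) -(lin_sum lins) -(basis_expand basis yN).
  apply: le_trans (basis_sum_le basis (d := eps2) Pny _) _; first exact: hP.
  by rewrite -/s /eps2 mulrCA ger_pMr // ler_pdivrMr // mul1r lerDr.
have [->|jn] := eqVneq j n.
  rewrite en (_ : eps = 8 * eps1); last by rewrite /eps1; field.
  exact: (rP _ _ (e n)).
rewrite (_ : eps = 8 * eps1); last by rewrite /eps1; field.
set c := inner (e j) y.
have c1 : nrm c <= 1.
  by have := cauchy_schwarz (e j) y; rewrite (basis_nrm basis) y1 mulr1.
have sj : swap n y (e j) = c *: e n.
  by rewrite /swap (basis_orth basis jn) scale0r add0r.
have linh := repr_linear repr h.
rewrite sj; apply: (rP _ _ (c *: y)).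
- by rewrite -sj; apply: le_trans eps21; exact: hP.
- rewrite (linZ linh) -scalerBr nrmZ.
  by have := nrm_ge0 (pi h (e n) - y); nra.
- rewrite (linZ linh) -scalerBr nrmZ.
  by have := nrm_ge0 (pi h y - e n); nra.
Qed.

(** Elements of [A] act by lower triangular matrices, so the column of [a] at
    [e j] can be read off from the column of [a + a^*] as soon as its diagonal
    entry is real. *)
Lemma lower_triangular_part n j a y (eps : R) : (n <= j)%N -> P n.+1 y -> A a ->
  Num.conj (inner (pi a (e j)) (e j)) = inner (pi a (e j)) (e j) ->
  nrm (pi (a + star a) (e j) - ((8 : R[i]) *: e j + swap n y (e j))) <= eps ->
  nrm (pi a (e j) - ((4 : R[i]) *: e j + inner (e j) (e n) *: y)) <= 2 * eps.
Proof.
move=> nj Py Aa; set al := inner (pi a (e j)) (e j) => al_real.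
set u := pi (a + star a) (e j) - _ => ueps.
(* [v] is the part of the error below the diagonal; the rest of [u] is
   orthogonal to it. *)
pose v := pi a (e j) - al *: e j - inner (e j) (e n) *: y.
have Pv : P j.+1 v.
  apply: (manifoldB (linP j.+1)).
    by apply: (basis_split basis); apply: invP => //; exact: basis_mem basis j.
  have [nj'|jn] := eqVneq n j; first by rewrite -nj'; exact: (manifoldZ (linP n.+1)).
  by rewrite (basis_orth basis) 1?eq_sym // scale0r; exact: manifold0.
have ejv : inner (e j) v = 0 by exact: (basis_perp basis (ltnSn j) Pv).
have env : inner (e n) v = 0 by exact: (basis_perp basis _ Pv).
have asv : inner (pi (star a) (e j)) v = 0.
  by apply: star_perp Pv => // w; exact: (basis_perp basis (ltnSn j)).
have uv : inner u v = inner v v.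
  rewrite {1}/u {2}/v (reprD repr) /swap !(innerDl, innerNl, innerZl).
  by rewrite ejv env asv; ring.
have vu : nrm v <= nrm u.
  have [->|v0] := eqVneq v 0; first by rewrite nrm0 nrm_ge0.
  rewrite -(ler_pM2r (nrm_gt0 v0)); have := cauchy_schwarz u v.
  by rewrite uv inner_nrm -realcX nrm_real ger0_norm ?sqr_ge0 // expr2.
have ue : inner u (e j) = 2 * (al - 4).
  have -> : inner u (e j) = inner (pi a (e j)) (e j) +
      inner (pi (star a) (e j)) (e j) - 8 - inner (swap n y (e j)) (e j).
    by rewrite /u (reprD repr) !(innerDl, innerNl, innerZl) (basis_inner basis); ring.
  rewrite [inner (pi (star a) _) _](repr_star repr) starK
     [inner (e j) _]innerC -/al al_real.
  have -> : inner (swap n y (e j)) (e j) = 0.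
    rewrite /swap !innerE; have [<-|jn] := eqVneq n j.
      rewrite (basis_perp basis (ltnSn n) Py).
      by rewrite (inner_eq0C (basis_perp basis (ltnSn n) Py)) !(mulr0, mul0r) addr0.
    by rewrite (basis_orth basis jn) (basis_orth basis) 1?eq_sym // !(mulr0, mul0r) addr0.
  by ring.
have al4 : 2 * nrm (al - 4) <= nrm u.
  have := cauchy_schwarz u (e j).
  by rewrite ue (basis_nrm basis) mulr1 nrmM nrm_nat.
have -> : pi a (e j) - ((4 : R[i]) *: e j + inner (e j) (e n) *: y) =
    v + (al - 4) *: e j.
  by apply: inner_ext => z; rewrite /v !innerE; ring.
apply: le_trans (nrmD _ _) _; rewrite nrmZ (basis_nrm basis) mulr1.
by have := nrm_ge0 (al - 4); lra.
Qed.

(** Density of [A + A^*] realizes [8 + r] as [a + a^*] with [a] in [A], up to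
    [delta]; subtracting a self-adjoint diagonal element from the
    imaginary part makes finitely many diagonal entries of [a] real. *)
Lemma triangular_real_part N r (delta : R) : star r = r -> 0 < delta ->
  exists a, [/\ A a, nrm (a + star a - ((8 : R[i]) *: aone + r)) <= delta &
    forall j, (j < N)%N ->
      Num.conj (inner (pi a (e j)) (e j)) = inner (pi a (e j)) (e j)].
Proof.
move=> rs delta0; set c := _ + r.
have cs : star c = c by rewrite /c starD starZ star1 rs rmorph_nat.
have : closure [set x + y | x in A & y in (star @` A : set C)] c by rewrite densA.
move=> /closure_nrm/(_ _ delta0)[_ [x Ax [_ [b Ab <-] <-]] xbc].
pose a0 := (2^-1 : R[i]) *: (x + b).
have half : Num.conj (2^-1 : R[i]) = 2^-1 by rewrite fmorphV rmorph_nat.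
have Aa0 : A a0 by apply: manifoldZ => //; exact: manifoldD.
have n2 : nrm (2^-1 : R[i]) = 2^-1.
  by rewrite nrmV nrm_nat.
have a0c : nrm (a0 + star a0 - c) <= delta.
  have -> : a0 + star a0 - c =
      - ((2^-1 : R[i]) *: ((c - (x + star b)) + star (c - (x + star b)))).
    rewrite starD starN starD starK cs /a0 starZ half starD.
    have {1}-> : c = (2^-1 : R[i]) *: (c + c).
      by rewrite scalerDr -scalerDl (_ : 2^-1 + 2^-1 = 1) ?scale1r //; field.
    rewrite -scalerDr -scalerBr -scalerN; congr (_ *: _).
    rewrite [RHS]opprD !opprB [RHS]addrACA -opprD; congr (_ - _).
    by rewrite addrACA [RHS]addrACA; congr (_ + _); exact: addrC.
  rewrite nrmN nrmZ n2; have := nrmD (c - (x + star b)) (star (c - (x + star b))).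
  by rewrite nrm_star; lra.
clearbody a0; have [d [Dd ds dP]] := diagonal_interpolation algA repr basis latP masa_pi N
  (fun j => complex.Im (inner (pi a0 (e j)) (e j))).
exists (a0 - I *: d); split.
- apply: manifoldB => //; apply: manifoldZ => //.
  by have /diagonalE[] := Dd.
- rewrite starD starN starZ ds conj_i scaleNr opprK addrACA addNr addr0.
  exact: a0c.
- move=> j jN; rewrite !(reprE repr) dP // !innerE (basis_inner basis).
  case: (inner _ _) => p q; rewrite mulr1.
  by apply/eqP; rewrite eq_complex /=; apply/andP; split; apply/eqP; ring.
Qed.

(** Let [r] be bounded by [4] and close to [swap n y], and let [a] in [A] have
    [a + a^*] close to [8 + r].  This sum is nonnegative up to a small
    error, so [(1 + a)^-1] exists in [A] and is bounded by [2].  On the relevant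
    vectors [a] is close to [4 + T], where [T] sends [e n] to [y] and kills [y];
    hence [(1 + a)^-1] sends [e n] close to [w = e n / 5 - y / 25], and
    [5 - 25 (1 + a)^-1] sends it close to [y]. *)
Lemma bounded_transitivity_unit n N y (eps : R) : (n < N)%N -> P n.+1 y ->
  nrm y = 1 -> (forall v, P N v -> inner y v = 0) -> 0 < eps ->
  exists g, [/\ A g, nrm g <= 55 & nrm (pi g (e n) - y) <= eps].
Proof.
move=> nN Py y1 yN eps0; have [_ A1 _] := algA.
pose s := \sum_(k <- iota 0 N) nrm (inner y (e k)).
have s0 : 0 <= s by apply: sumr_ge0 => k _; exact: nrm_ge0.
have s1 : 0 < 100 * (1 + s) by rewrite mulr_gt0 // ltr_wpDr.
pose eta := eps / (100 * (1 + s)); have eta0 : 0 < eta by rewrite divr_gt0.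
have eta2 : 0 < eta / 2 by rewrite divr_gt0.
have [r [rs r4 rP]] := bounded_swap nN Py y1 yN eta2.
pose delta := Num.min (eta / 2) 1.
have delta0 : 0 < delta by rewrite lt_min eta2 ltr01.
have [a [Aa ac a_real]] := triangular_real_part N rs delta0.
pose err j := pi a (e j) - ((4 : R[i]) *: e j + inner (e j) (e n) *: y).
have errP j : (n <= j < N)%N -> nrm (err j) <= 2 * eta.
  move=> /[dup] njN /andP[nj jN]; apply: lower_triangular_part => //.
    exact: a_real.
  have -> : pi (a + star a) (e j) - ((8 : R[i]) *: e j + swap n y (e j)) =
      pi (a + star a - ((8 : R[i]) *: aone + r)) (e j) +
      (pi r (e j) - swap n y (e j)).
    by rewrite !(reprE repr); apply: inner_ext => z; rewrite !innerE; ring.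
  apply: le_trans (nrmD _ _) _; rewrite (splitr eta) lerD // ?rP //.
  apply: le_trans (nrm_repr repr _ _) _; rewrite (basis_nrm basis) mulr1.
  by apply: le_trans ac _; rewrite ge_min lexx.
have [|t /andP[t0 t8]|g [Ag gl _ g2]] :=
    @accretive_inverse_real_part R C A a 8^-1 clA algA Aa.
- by rewrite invr_gt0.
- have -> : aone - t%:C *: (a + star a) = (1 - 8 * t)%:C *: aone - t%:C *: r -
      t%:C *: (a + star a - ((8 : R[i]) *: aone + r)).
    move: (a + star a) => X; rewrite scalerBr opprB scalerDr addrA addrACA addNr.
    rewrite addr0.
    rewrite scalerA -scalerDl (_ : _ + _ * 8 = 1) ?scale1r // !realcE.
    by ring.
  apply: le_trans (nrmB _ _) _.
  have := nrmB ((1 - 8 * t)%:C *: (aone : C)) (t%:C *: r).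
  have t8' : 0 <= 1 - 8 * t by lra.
  have d1 : delta <= 1 by rewrite ge_min lexx orbT.
  rewrite !nrmZ !nrm_real (ger0_norm t8') (gtr0_norm t0).
  have := nrm_aone (C := C); nra.
pose w := (5^-1 : R[i]) *: e n - (25^-1 : R[i]) *: y.
have Pny : P n y by exact: (basis_sub basis (leqnSn n)).
have yn : inner y (e n) = 0 by apply: inner_eq0C; exact: (basis_perp basis (ltnSn n) Py).
have yE := basis_expand basis yN.
have wE : pi (aone + a) w - e n = (5^-1 : R[i]) *: err n -
    (25^-1 : R[i]) *: \sum_(k <- iota 0 N) inner y (e k) *: err k.
  have lin := repr_linear repr a.
  have -> : \sum_(k <- iota 0 N) inner y (e k) *: err k =
      pi a y - (4 : R[i]) *: y.
    have linf : linear (fun v => pi a v - ((4 : R[i]) *: v + inner v (e n) *: y)).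
      by move=> k u v; rewrite lin; apply: inner_ext => z; rewrite !innerE; ring.
    under eq_bigr do rewrite -(linZ linf).
    by rewrite -(lin_sum linf) -yE yn scale0r addr0.
  rewrite /w /err !(reprE repr) (linB lin) !(linZ lin) (basis_inner basis).
  by apply: inner_ext => z; rewrite !innerE; field.
have n25 : nrm (25 : R[i]) = 25 by exact: nrm_nat.
have n5 : nrm (5 : R[i]) = 5 by exact: nrm_nat.
have werr : nrm (pi (aone + a) w - e n) <= 2 * eta * (1 + s).
  rewrite wE; apply: le_trans (nrmB _ _) _; rewrite !nrmZ.
  have := basis_sum_le basis Pny errP; rewrite -/s.
  have := errP n; rewrite leqnn nN => /(_ isT).
  rewrite !nrmV n5 n25; have := nrm_ge0 (err n).
  have : 0 <= s * eta by rewrite mulr_ge0 // ltW.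
  by move: (nrm _) (nrm _) => p q; lra.
have gw : nrm (pi g (e n) - w) <= 4 * eta * (1 + s).
  rewrite nrm_sym -[w](repr1 repr) -gl (reprM repr) -(linB (repr_linear repr g)).
  apply: le_trans (nrm_repr repr _ _) _.
  by move: g2 werr (nrm_ge0 g) (nrm_ge0 (pi (aone + a) w - e n)); nra.
exists ((5 : R[i]) *: aone - (25 : R[i]) *: g); split.
- by apply: manifoldB => //; apply: manifoldZ.
- apply: le_trans (nrmB _ _) _; rewrite !nrmZ n5 n25.
  by have := nrm_aone (C := C); lra.
- have -> : pi ((5 : R[i]) *: aone - (25 : R[i]) *: g) (e n) - y =
      - ((25 : R[i]) *: (pi g (e n) - w)).
    by rewrite !(reprE repr) /w; apply: inner_ext => z; rewrite !innerE; field.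
  rewrite nrmN nrmZ n25; apply: (@le_trans _ _ (25 * (4 * eta * (1 + s)))).
    by rewrite ler_pM2l.
  by rewrite /eta le_eqVlt; apply/orP; left; apply/eqP; field; rewrite gt_eqF // ltr_wpDr.
Qed.

(** Split [y] into a multiple of [e n], a finitely supported vector of norm at
    most [3 * nrm y], and a small remainder; [1 + 55 * 3 <= 200]. *)
Lemma bounded_transitivity n y : P n y ->
  exists a, [/\ A a, nrm a <= 200 * nrm y & nrm (pi a (e n) - y) <= nrm y / 4].
Proof.
move=> Py; have [_ A1 _] := algA.
have [->|y0] := eqVneq y 0.
  exists 0; rewrite !nrm0; split; [exact: manifold0|lra|].
  by rewrite subr0 -(scale0r (aone : C)) (reprZ repr) scale0r nrm0; lra.
have ny0 := nrm_gt0 y0.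
set c := inner y (e n).
have cy : nrm c <= nrm y.
  by have := cauchy_schwarz y (e n); rewrite (basis_nrm basis) mulr1.
pose y' := y - c *: e n.
have Py' : P n.+1 y' by exact: (basis_split basis Py).
have y'y : nrm y' <= 2 * nrm y.
  by apply: le_trans (nrmB _ _) _; rewrite nrmZ (basis_nrm basis) mulr1; lra.
have e16 : 0 < nrm y / 16 by rewrite divr_gt0.
have [N [u [Pu uN y'u]]] := basis_dense basis Py' e16.
have u3 : nrm u <= 3 * nrm y.
  by have := nrm_le_add u y'; rewrite nrm_sym; lra.
suff [g [Ag gu gn]] : exists g, [/\ A g, nrm g <= 55 * nrm u &
    nrm (pi g (e n) - u) <= nrm u / 24].
  exists (c *: aone + g); split.
  - by apply: manifoldD => //; exact: manifoldZ.
  - apply: le_trans (nrmD _ _) _; rewrite nrmZ.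
    by have := nrm_aone (C := C); have := nrm_ge0 c; nra.
  - have -> : pi (c *: aone + g) (e n) - y = (pi g (e n) - u) - (y' - u).
      by rewrite !(reprE repr) /y'; apply: inner_ext => z; rewrite !innerE; ring.
    by apply: le_trans (nrmB _ _) _; lra.
have [->|u0] := eqVneq u 0.
  exists 0; rewrite !nrm0; split; [exact: manifold0|lra|].
  by rewrite subr0 -(scale0r (aone : C)) (reprZ repr) scale0r nrm0; lra.
have nu0 := nrm_gt0 u0.
pose v := ((nrm u)^-1)%:C *: u.
have vu : (nrm u)%:C *: v = u.
  by rewrite /v scalerA -realcM mulfV ?scale1r // gt_eqF.
have [|||w Pw||g [Ag g55 gv]] := @bounded_transitivity_unit n (maxn n.+1 N) v 24^-1.
- exact: leq_maxl.
- exact: manifoldZ.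
- exact: normalize_unit.
- by rewrite innerZl uN ?mulr0 //; apply: (basis_sub basis (leq_maxr n.+1 N)).
- by rewrite invr_gt0.
exists ((nrm u)%:C *: g); split; first exact: manifoldZ.
  by rewrite nrmZ nrm_real gtr0_norm // mulrC ler_pM2r.
rewrite (reprZ repr) -{2}vu -scalerBr nrmZ nrm_real gtr0_norm //.
by rewrite ler_pM2l.
Qed.

(** Since [x] can be moved close to [e n], bounded transitivity from [e n]
    supplies approximate solutions of [pi a x = y] with norm control; closedness
    of [A] makes them exact. *)
Lemma orbit_full n x : P n x -> ~ P n.+1 x -> [set pi a x | a in A] = P n.
Proof.
move=> Px nPx; have [_ _ AM] := algA.
apply/seteqP; split=> [_ [a Aa <-]|y Py]; first exact: invP.
have d0 : 0 < ((4 * 200)^-1 : R) by rewrite invr_gt0 mulr_gt0 // ltr0n.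
have [b Ab bx] := orbit_dense Px nPx (basis_mem basis n) d0.
have linL : linear (fun a => pi a x).
  by have [_ lpi _ _ _] := repr; move=> k u v; rewrite lpi.
have [a||v Pv|a [Aa ax _]] := @approximate_solutions_exact R C H A (P n)
    (fun a => pi a x) (nrm x) (200 * nrm b) 2^-1 clA linA linL _ _ _ y Py.
- by rewrite mulrC; exact: nrm_repr.
- by rewrite invr_ge0 ler0n /= invf_lt1 // ltr1n.
- have [a [Aa av an]] := bounded_transitivity Pv.
  exists (a ** b); split; first exact: AM.
  + apply: le_trans (nrm_amul _ _) _.
    by have := nrm_ge0 b; nra.
  + by apply: (manifoldB (linP n)) => //; apply: invP => //; exact: AM.
  + rewrite (reprM repr) nrm_sym.
    have -> : pi a (pi b x) - v = pi a (pi b x - e n) + (pi a (e n) - v).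
      by rewrite (linB (repr_linear repr a)) addrA subrK.
    apply: le_trans (nrmD _ _) _.
    have := nrm_repr repr a (pi b x - e n); have := nrm_ge0 (pi b x - e n).
    by have := nrm_ge0 v; have := nrm_ge0 a; nra.
by exists a.
Qed.

Lemma manifold_closed_singly_generated (M : set H) :
  linear_manifold M -> invariant_under pi A M ->
  closed M /\ singly_generated pi A M.
Proof.
move=> linM invM; have [P0 Pcap _ _ _] := basis.
have [M0|] := pselect (exists2 x, M x & x != 0); last first.
  move=> M0; have -> : M = [set 0].
    apply/seteqP; split=> x; last by move->; exact: manifold0.
    by move=> Mx; apply/eqP; apply: contraT => x0; case: M0; exists x.
  split.
    move=> z /closure_nrm z0; apply: nrm_eps_eq0 => eps /z0[_ ->].
    by rewrite subr0 => /ltW.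
  exists 0; apply/seteqP; split=> [x ->|_ [a Aa <-]].
    by exists 0; [exact: manifold0|rewrite (lin0 (repr_linear repr 0))].
  by rewrite (lin0 (repr_linear repr a)).
(* The least [n] for which [M] is not contained in [P n.+1]. *)
pose leaves n := `[< exists2 x, M x & ~ P n.+1 x >].
have ex : exists n, leaves n.
  have [x Mx /eqP x0] := M0.
  have /existsNP[k nPk] : ~ forall k, P k x.
    by move=> Px; apply: x0; rewrite -[x = 0]/([set 0] x) -Pcap => k _.
  case: k nPk => [|k] nPk; first by case: nPk; rewrite P0.
  by exists k; apply/asboolP; exists x.
case: (ex_minnP ex) => n /asboolP[x Mx nPx] min_n.
have MP z : M z -> P n z.
  move=> Mz; case: n nPx min_n => [|n] nPx min_n; first by rewrite P0.
  have [//|nPz] := pselect (P n.+1 z).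
  have /min_n : leaves n by apply/asboolP; exists z.
  by rewrite ltnn.
have orbit := orbit_full (MP _ Mx) nPx.
have -> : M = P n.
  apply/seteqP; split=> [z|z]; first exact: MP.
  by rewrite -orbit => -[a Aa <-]; exact: invM.
by split; [exact: basis_closed basis n|exists x].
Qed.

End Transitivity.

Theorem theorem10 (R : realType) (C : cstarAlgType R) (A : set C)
  (H : hilbertType R) (pi : C -> H -> H) :
  AF C ->
  strongly_maximal_triangular A ->
  separable_space H ->
  star_representation pi ->
  masa_preserving pi A ->
  has_order_type_negN pi A ->
  multiplicity_free pi A ->
  forall M : set H, linear_manifold M -> invariant_under pi A M ->
    closed M /\ singly_generated pi A M.
Proof.
move=> _ [[clA algA _] densA] _ repr masa_pi order mult_free.
have [P [e [basis latP]]] := nest_basis_exists order mult_free.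
exact: (manifold_closed_singly_generated clA algA densA repr masa_pi basis latP).
Qed.
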